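(* Let the assumptions (A1) and (A2) of the context hold. Let $(x_*,u_* )$ be a local minimizer of $$\text{(P)}\qquad \min_{x,u}\ \Phi(x)\quad\text{s.t.}\quad x=w(u),\ h(x)\ge0,\ b(u)\ge0,$$ with $h(x_* )>0$, and let $\mathcal{N}\subseteq\mathbb{R}^n\times\mathbb{R}^m$ be a neighborhood in which $(x_*,u_* )$ is the only critical point of (P). Consider the closed-loop system $$\text{(CL)}\qquad \dot\xi(t)=f(\xi(t),\upsilon(t)),\qquad \dot\upsilon(t)=g_{\epsilon,\alpha,\gamma}(\xi(t),\upsilon(t)).$$ Assume that: - $u\mapsto\Phi(w(u))$ has compact level sets; - the controller's quadratic program $\mathrm{QP}_{\epsilon,\alpha,\gamma}(x,u)$ is feasible for every $(x,u)\in\mathcal{N}$; - MFCQ or CRCQ holds in $\mathcal{N}$ for (P) and for $\mathrm{QP}_{\epsilon,\alpha,\gamma}$; and - unique solutions of (CL) exist for any initial condition in $\mathcal{N}$. Then there exist $\epsilon_*,\gamma_*>0$ such that, for any $\epsilon\in(0,\epsilon_* )$ and $\gamma\ge\gamma_*$, the point $(x_*,u_* )$ is locally asymptotically stable relative to $\mathcal{X}_r$ for the closed-loop dynamics (CL).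
   Context: Conventions: for $g:\mathbb{R}^n\times\mathbb{R}^m\to\mathbb{R}^k$, $\frac{\partial g}{\partial x}(x,u)\in\mathbb{R}^{k\times n}$; for scalar $g$, $\nabla g=(\frac{\partial g}{\partial x})^\top$ is a column vector, and $\nabla^\top g=(\nabla g)^\top$. Data: a control system $\dot\xi=f(\xi,\upsilon)$ with $f:\mathbb{R}^n\times\mathbb{R}^m\to\mathbb{R}^n$; functions $\Phi:\mathbb{R}^n\to\mathbb{R}$, $h:\mathbb{R}^n\to\mathbb{R}$, $b:\mathbb{R}^m\to\mathbb{R}$, sufficiently smooth. (A1) For any constant input $\upsilon(t)=u$, the system has a unique equilibrium, which is globally exponentially stable. $w:\mathbb{R}^m\to\mathbb{R}^n$ maps $u$ to this equilibrium, so $f(w(u),u)=0$. Notation: $\mathcal{L}_f h(x,u)=\frac{\partial h}{\partial x}(x)f(x,u)$ and $\mathcal{L}_f^i h(x,u)=\frac{\partial \mathcal{L}_f^{i-1}h}{\partial x}(x,u)f(x,u)$ for $i\ge2$. For a fixed $\beta>0$: $h_0(x,u):=h(x)$ and $h_i(x,u):=\frac{\partial h_{i-1}}{\partial x}(x,u)f(x,u)+\beta h_{i-1}(x,u)$ for $i\ge1$. Also $\mathcal{X}_i:=\{(x,u)\in\mathbb{R}^n\times\mathbb{R}^m: h(x)\ge0,\ b(u)\ge0,\ h_i(x,u)\ge0\}$ for $i\ge 0$. (A2) (1) There exists an integer $r\ge1$ such that: $f$ is $(r+1)$-times and $h$ is $(r+2)$-times continuously differentiable; $\mathcal{X}_r\ne\emptyset$;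 $\frac{\partial \mathcal{L}_f^r h}{\partial u}(x,u)\ne0$ for all $(x,u)\in\mathcal{X}_r$ with $h_r(x,u)=0$; and $\frac{\partial\mathcal{L}_f^i h}{\partial u}(x,u)=0$ for all $(x,u)\in\mathcal{X}_r$ and all $i<r$. (2) $b$ is twice continuously differentiable, and $b(u)=0\implies\nabla b(u)\ne0$ for all $(x,u)\in\mathcal{X}:=\{(x,u): h(x)\ge0,\ b(u)\ge0\}$. (3) $\Phi$ and $w$ are twice continuously differentiable. Throughout, $r$ is the integer in (A2). Controller: $\epsilon,\alpha,\gamma>0$ are controller parameters to be designed. $\mathrm{QP}_{\epsilon,\alpha,\gamma}(x,u)$ is the quadratic program in $q\in\mathbb{R}^m$ $$\min_q\ \tfrac12\Big\|q+\epsilon\tfrac{\partial w}{\partial u}(u)^\top\nabla\Phi(x)\Big\|^2\ \text{ s.t. }\ \nabla^\top b(u)q+\alpha b(u)\ge0,\quad \tfrac{\partial h_r}{\partial x}(x,u)f(x,u)+\tfrac{\partial h_r}{\partial u}(x,u)q+\gamma h_r(x,u)\ge0,$$ and $g_{\epsilon,\alpha,\gamma}(x,u)$ is its (unique, when feasible) minimizer. A critical point of (P) is a point satisfying its Karush-Kuhn-Tucker (KKT) conditions. Constraint qualifications: for a parametric problem $\min_y\Psi(y,\theta)$ s.t. $a_i(y,\theta)\ge0$, $i\in\{1,\dots,p\}$, with $J(y,\theta)=\{i:a_i(y,\theta)=0\}$: MFCQ (Mangasarian-Fromovitz) holds at $(y_*,\theta_* )$ if there is a vector $v$ with $\frac{\partial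 a_i}{\partial y}(y_*,\theta_* )v>0$ for all $i\in J(y_*,\theta_* )$; CRCQ (constant rank) holds at $(y_*,\theta_* )$ if for every $I\subseteq J(y_*,\theta_* )$ the family $\{\frac{\partial a_i}{\partial y}(y,\theta)\}_{i\in I}$ has constant rank for $(y,\theta)$ near $(y_*,\theta_* )$. For the QP, $y=q$ and $\theta=(x,u)$, and the qualification ''in $\mathcal{N}$'' is required for every $(x,u)\in\mathcal{N}$ at the minimizer $q=g_{\epsilon,\alpha,\gamma}(x,u)$. For (P) (no parameter, decision variable $(x,u)$) the qualification is required at the feasible points of (P) in $\mathcal{N}$; since (P) also has the equality constraint $x-w(u)=0$, the standard versions with equality constraints are meant: for MFCQ, the equality-constraint gradients are linearly independent and $v$ additionally lies in their orthogonal complement; for CRCQ, the equality-constraint gradients are included among the active ones. Asymptotic stability relative to a set $S$ means that the region of attraction is contained in $S$: i.e., stability and attractivity are understood for initial conditions in $S$ near the point (for every neighborhood $U$ of the point there is a neighborhood $U'$ such that solutions starting in $U'\cap S$ remain in $U$ for all $t\ge0$, and solutions starting in $S$ sufficiently close to the point converge to it). *)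

(* Defs.v *)
From HB Require Import structures.
From mathcomp Require Import all_boot all_order all_algebra.
From mathcomp Require Import all_classical all_reals all_analysis.

Set Implicit Arguments.
Unset Strict Implicit.
Unset Printing Implicit Defensive.

Import Order.TTheory GRing.Theory Num.Theory.
Import numFieldNormedType.Exports.

Local Open Scope classical_set_scope.
Local Open Scope ring_scope.

Definition dot (R : realType) (d : nat) (a b : 'cV[R]_d) : R :=
  (a^T *m b) 0 0.

Definition grad (R : realType) (d : nat) (g : 'cV[R]_d -> R) (y : 'cV[R]_d) :
  'cV[R]_d := \col_j 'D_(delta_mx j 0) g y.

(* Vectors are columns and Jacobians have one row per component. The library's
   jacobian acts on row vectors and is the transpose of this one. *)
Definition jac (R : realType) (d k : nat) (g : 'cV[R]_d -> 'cV[R]_k)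
  (y : 'cV[R]_d) : 'M[R]_(k, d) :=
  \matrix_(i, j) ('D_(delta_mx j 0) g y) i 0.

(* The gradient and the Jacobian in the joint variable (x, u). *)
Definition grad2 (R : realType) (n m : nat)
  (g : 'cV[R]_n * 'cV[R]_m -> R) (z : 'cV[R]_n * 'cV[R]_m) : 'cV[R]_(n + m) :=
  col_mx (grad (fun x => g (x, z.2)) z.1) (grad (fun u => g (z.1, u)) z.2).

Definition jac2 (R : realType) (n m k : nat)
  (g : 'cV[R]_n * 'cV[R]_m -> 'cV[R]_k) (z : 'cV[R]_n * 'cV[R]_m) :
  'M[R]_(k, n + m) :=
  row_mx (jac (fun x => g (x, z.2)) z.1) (jac (fun u => g (z.1, u)) z.2).

(* k-times continuously differentiable; meant for finite-dimensional V, where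
   it suffices that every directional derivative is of class C^(k-1). *)
Fixpoint Ck (R : realType) (V W : normedModType R) (k : nat) (g : V -> W) :
  Prop :=
  if k is k'.+1 then
    (forall x, differentiable g x) /\ (forall v, Ck k' (fun x => 'D_v g x))
  else continuous g.

(* A solution on [0, T) is the restriction of a function on R. Asking for a
   two-sided derivative at 0 loses no solution: one whose right derivative at 0
   is the prescribed one extends linearly to t < 0. *)
Definition const_input_solution (R : realType) (n m : nat)
  (f : 'cV[R]_n -> 'cV[R]_m -> 'cV[R]_n) (u : 'cV[R]_m)
  (T : \bar R) (xi : R -> 'cV[R]_n) : Prop :=
  forall t : R, 0 <= t -> (t%:E < T)%E ->
    is_derive t (1 : R) xi (f (xi t) u).

(* The library norm is the sup norm; the choice of norm only affects k. *)
Definition globally_exp_stable (R : realType) (n m : nat)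
  (f : 'cV[R]_n -> 'cV[R]_m -> 'cV[R]_n) (u : 'cV[R]_m) (xe : 'cV[R]_n) :
  Prop :=
  (forall x0, exists xi, const_input_solution f u +oo%E xi /\ xi 0 = x0) /\
  exists k lambda : R, [/\ 0 < k, 0 < lambda &
    forall (T : \bar R) (xi : R -> 'cV[R]_n), const_input_solution f u T xi ->
      forall t : R, 0 <= t -> (t%:E < T)%E ->
        `|xi t - xe| <= k * expR (- lambda * t) * `|xi 0 - xe| ].

Definition assumptionA1 (R : realType) (n m : nat)
  (f : 'cV[R]_n -> 'cV[R]_m -> 'cV[R]_n) (w : 'cV[R]_m -> 'cV[R]_n) : Prop :=
  forall u, (forall x, f x u = 0 <-> x = w u) /\ globally_exp_stable f u (w u).

Fixpoint lie (R : realType) (n m : nat)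
  (f : 'cV[R]_n -> 'cV[R]_m -> 'cV[R]_n) (h : 'cV[R]_n -> R) (i : nat)
  (x : 'cV[R]_n) (u : 'cV[R]_m) : R :=
  if i is i'.+1 then dot (grad (fun y => lie f h i' y u) x) (f x u) else h x.

Fixpoint hseq (R : realType) (n m : nat)
  (f : 'cV[R]_n -> 'cV[R]_m -> 'cV[R]_n) (h : 'cV[R]_n -> R) (beta : R)
  (i : nat) (x : 'cV[R]_n) (u : 'cV[R]_m) : R :=
  if i is i'.+1 then
    dot (grad (fun y => hseq f h beta i' y u) x) (f x u)
      + beta * hseq f h beta i' x u
  else h x.

Definition Xset (R : realType) (n m : nat)
  (f : 'cV[R]_n -> 'cV[R]_m -> 'cV[R]_n) (h : 'cV[R]_n -> R)
  (b : 'cV[R]_m -> R) (beta : R) (i : nat) : set ('cV[R]_n * 'cV[R]_m) :=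
  [set z | [/\ 0 <= h z.1, 0 <= b z.2 & 0 <= hseq f h beta i z.1 z.2] ].

Definition assumptionA2 (R : realType) (n m : nat)
  (f : 'cV[R]_n -> 'cV[R]_m -> 'cV[R]_n) (Phi h : 'cV[R]_n -> R)
  (b : 'cV[R]_m -> R) (w : 'cV[R]_m -> 'cV[R]_n) (beta : R) (r : nat) : Prop :=
  [/\ [/\ (1 <= r)%N,
          Ck r.+1 (fun z : 'cV[R]_n * 'cV[R]_m => f z.1 z.2) /\ Ck r.+2 h,
          Xset f h b beta r !=set0,
          (forall x u, Xset f h b beta r (x, u) -> hseq f h beta r x u = 0 ->
             grad (fun v => lie f h r x v) u <> 0) &
          (forall x u i, Xset f h b beta r (x, u) -> (i < r)%N ->
             grad (fun v => lie f h i x v) u = 0) ],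
      Ck 2 b /\
      (forall x u, 0 <= h x -> 0 <= b u -> b u = 0 -> grad b u <> 0) &
      Ck 2 Phi /\ Ck 2 w].

(* Problem (P): minimize Phi(x) over z = (x, u) subject to
   x - w(u) = 0, h(x) >= 0, b(u) >= 0. *)
Definition P_eq (R : realType) (n m : nat) (w : 'cV[R]_m -> 'cV[R]_n)
  (z : 'cV[R]_n * 'cV[R]_m) : 'cV[R]_n := z.1 - w z.2.

Definition P_ineq (R : realType) (n m : nat) (h : 'cV[R]_n -> R)
  (b : 'cV[R]_m -> R) (z : 'cV[R]_n * 'cV[R]_m) : 'cV[R]_2 :=
  \col_i (if i == 0 then h z.1 else b z.2).

Definition P_feasible (R : realType) (n m : nat) (h : 'cV[R]_n -> R)
  (b : 'cV[R]_m -> R) (w : 'cV[R]_m -> 'cV[R]_n)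
  (z : 'cV[R]_n * 'cV[R]_m) : Prop :=
  P_eq w z = 0 /\ forall i, 0 <= P_ineq h b z i 0.

Definition P_local_minimizer (R : realType) (n m : nat)
  (Phi h : 'cV[R]_n -> R) (b : 'cV[R]_m -> R) (w : 'cV[R]_m -> 'cV[R]_n)
  (z : 'cV[R]_n * 'cV[R]_m) : Prop :=
  P_feasible h b w z /\
  \forall z' \near z, P_feasible h b w z' -> Phi z.1 <= Phi z'.1.

Definition P_critical (R : realType) (n m : nat)
  (Phi h : 'cV[R]_n -> R) (b : 'cV[R]_m -> R) (w : 'cV[R]_m -> 'cV[R]_n)
  (z : 'cV[R]_n * 'cV[R]_m) : Prop :=
  P_feasible h b w z /\
  exists (lambda : 'cV[R]_n) (mu : 'cV[R]_2),
    [/\ forall i, 0 <= mu i 0,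
        forall i, mu i 0 * P_ineq h b z i 0 = 0 &
        grad2 (fun z' => Phi z'.1) z =
          (jac2 (P_eq w) z)^T *m lambda + (jac2 (P_ineq h b) z)^T *m mu].

Definition active (R : realType) (p : nat) (a : 'cV[R]_p) : {set 'I_p} :=
  [set i | a i 0 == 0]%SET.

(* The rows of E are the gradients of the equality constraints, those of A the
   gradients of the inequality constraints, and J is the active set. *)
Definition MFCQ (R : realType) (k p d : nat) (E : 'M[R]_(k, d))
  (A : 'M[R]_(p, d)) (J : {set 'I_p}) : Prop :=
  row_free E /\
  exists v : 'cV[R]_d, E *m v = 0 /\ forall i, i \in J -> 0 < (A *m v) i 0.

(* The rows of A are the gradients of all constraints, equalities included. *)
Definition CRCQ (R : realType) (Z : topologicalType) (p d : nat)
  (A : Z -> 'M[R]_(p, d)) (J : {set 'I_p}) (z0 : Z) : Prop :=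
  forall I : {set 'I_p}, I \subset J ->
    \forall z \near z0, \rank (rowsub (@enum_val _ (mem I)) (A z)) =
                        \rank (rowsub (@enum_val _ (mem I)) (A z0)).

Definition P_MFCQ_in (R : realType) (n m : nat) (h : 'cV[R]_n -> R)
  (b : 'cV[R]_m -> R) (w : 'cV[R]_m -> 'cV[R]_n)
  (N : set ('cV[R]_n * 'cV[R]_m)) : Prop :=
  forall z, N z -> P_feasible h b w z ->
    MFCQ (jac2 (P_eq w) z) (jac2 (P_ineq h b) z) (active (P_ineq h b z)).

Definition P_CRCQ_in (R : realType) (n m : nat) (h : 'cV[R]_n -> R)
  (b : 'cV[R]_m -> R) (w : 'cV[R]_m -> 'cV[R]_n)
  (N : set ('cV[R]_n * 'cV[R]_m)) : Prop :=
  forall z, N z -> P_feasible h b w z ->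
    CRCQ (fun z' => col_mx (jac2 (P_eq w) z') (jac2 (P_ineq h b) z'))
         (active (col_mx (P_eq w z) (P_ineq h b z))) z.

Definition QP_ineq (R : realType) (n m : nat)
  (f : 'cV[R]_n -> 'cV[R]_m -> 'cV[R]_n) (h : 'cV[R]_n -> R)
  (b : 'cV[R]_m -> R) (beta : R) (r : nat) (alpha gamma : R)
  (q : 'cV[R]_m) (z : 'cV[R]_n * 'cV[R]_m) : 'cV[R]_2 :=
  \col_i (if i == 0 then dot (grad b z.2) q + alpha * b z.2
          else dot (grad (fun x => hseq f h beta r x z.2) z.1) (f z.1 z.2)
               + dot (grad (fun u => hseq f h beta r z.1 u) z.2) q
               + gamma * hseq f h beta r z.1 z.2).

Definition QP_feasible (R : realType) (n m : nat)
  (f : 'cV[R]_n -> 'cV[R]_m -> 'cV[R]_n) (h : 'cV[R]_n -> R)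
  (b : 'cV[R]_m -> R) (beta : R) (r : nat) (alpha gamma : R)
  (z : 'cV[R]_n * 'cV[R]_m) (q : 'cV[R]_m) : Prop :=
  forall i, 0 <= QP_ineq f h b beta r alpha gamma q z i 0.

Definition QP_cost (R : realType) (n m : nat) (Phi : 'cV[R]_n -> R)
  (w : 'cV[R]_m -> 'cV[R]_n) (eps : R) (z : 'cV[R]_n * 'cV[R]_m)
  (q : 'cV[R]_m) : R :=
  let d := q + eps *: ((jac w z.2)^T *m grad Phi z.1) in 2^-1 * dot d d.

(* The graph of the controller: q = g(x, u), a partial function defined where
   the quadratic program is feasible. *)
Definition QP_minimizer (R : realType) (n m : nat)
  (f : 'cV[R]_n -> 'cV[R]_m -> 'cV[R]_n) (Phi h : 'cV[R]_n -> R)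
  (b : 'cV[R]_m -> R) (w : 'cV[R]_m -> 'cV[R]_n) (beta : R) (r : nat)
  (eps alpha gamma : R) (z : 'cV[R]_n * 'cV[R]_m) (q : 'cV[R]_m) : Prop :=
  QP_feasible f h b beta r alpha gamma z q /\
  forall q', QP_feasible f h b beta r alpha gamma z q' ->
    QP_cost Phi w eps z q <= QP_cost Phi w eps z q'.

Definition QP_MFCQ_in (R : realType) (n m : nat)
  (f : 'cV[R]_n -> 'cV[R]_m -> 'cV[R]_n) (Phi h : 'cV[R]_n -> R)
  (b : 'cV[R]_m -> R) (w : 'cV[R]_m -> 'cV[R]_n) (beta : R) (r : nat)
  (eps alpha gamma : R) (N : set ('cV[R]_n * 'cV[R]_m)) : Prop :=
  forall z q, N z -> QP_minimizer f Phi h b w beta r eps alpha gamma z q ->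
    MFCQ (0 : 'M[R]_(0, m))
         (jac (fun q' => QP_ineq f h b beta r alpha gamma q' z) q)
         (active (QP_ineq f h b beta r alpha gamma q z)).

Definition QP_CRCQ_in (R : realType) (n m : nat)
  (f : 'cV[R]_n -> 'cV[R]_m -> 'cV[R]_n) (Phi h : 'cV[R]_n -> R)
  (b : 'cV[R]_m -> R) (w : 'cV[R]_m -> 'cV[R]_n) (beta : R) (r : nat)
  (eps alpha gamma : R) (N : set ('cV[R]_n * 'cV[R]_m)) : Prop :=
  forall z q, N z -> QP_minimizer f Phi h b w beta r eps alpha gamma z q ->
    CRCQ (fun y : 'cV[R]_m * ('cV[R]_n * 'cV[R]_m) =>
            jac (fun q' => QP_ineq f h b beta r alpha gamma q' y.2) y.1)
         (active (QP_ineq f h b beta r alpha gamma q z)) (q, z).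

(* Solutions z = (xi, upsilon) of the closed loop on [0, T). *)
Definition CL_solution (R : realType) (n m : nat)
  (f : 'cV[R]_n -> 'cV[R]_m -> 'cV[R]_n) (Phi h : 'cV[R]_n -> R)
  (b : 'cV[R]_m -> R) (w : 'cV[R]_m -> 'cV[R]_n) (beta : R) (r : nat)
  (eps alpha gamma : R) (T : \bar R) (z : R -> 'cV[R]_n * 'cV[R]_m) : Prop :=
  forall t : R, 0 <= t -> (t%:E < T)%E ->
    is_derive t (1 : R) (fun s => (z s).1) (f (z t).1 (z t).2) /\
    exists2 q, QP_minimizer f Phi h b w beta r eps alpha gamma (z t) q &
               is_derive t (1 : R) (fun s => (z s).2) q.

(* sol T z reads: z solves the system on [0, T). Two solutions are identified
   when they agree on their common interval of definition. *)
Definition unique_solutions_from (R : realType) (Z : Type)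
  (sol : \bar R -> (R -> Z) -> Prop) (N : set Z) : Prop :=
  forall z0, N z0 ->
    (exists (T : \bar R) (z : R -> Z), [/\ (0 < T)%E, sol T z & z 0 = z0]) /\
    (forall (T1 T2 : \bar R) (z1 z2 : R -> Z),
       sol T1 z1 -> sol T2 z2 -> z1 0 = z0 -> z2 0 = z0 ->
       forall t : R, 0 <= t -> (t%:E < T1)%E -> (t%:E < T2)%E -> z1 t = z2 t).

(* Solutions are only assumed to exist locally in time, so that remaining in U
   for all t >= 0 includes existence on [0, +oo). *)
Definition asymptotically_stable_rel (R : realType) (Z : topologicalType)
  (sol : \bar R -> (R -> Z) -> Prop) (S : set Z) (zs : Z) : Prop :=
  (forall U : set Z, nbhs zs U -> exists2 U' : set Z, nbhs zs U' &
     forall z0, U' z0 -> S z0 ->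
       (exists z : R -> Z, sol +oo%E z /\ z 0 = z0) /\
       (forall (T : \bar R) (z : R -> Z), sol T z -> z 0 = z0 ->
          forall t : R, 0 <= t -> (t%:E < T)%E -> U (z t))) /\
  (exists2 U' : set Z, nbhs zs U' &
     forall z : R -> Z, sol +oo%E z -> U' (z 0) -> S (z 0) ->
       z t @[t --> +oo] --> zs).

(* Main.v *)
Require Import Defs.
From HB Require Import structures.
From mathcomp Require Import all_boot all_order all_algebra.
From mathcomp Require Import all_classical all_reals all_analysis.
From mathcomp Require Import ring lra.
From mathcomp Require Import spectral complex.

Import Order.TTheory GRing.Theory Num.Theory.
Import numFieldNormedType.Exports.

Local Open Scope classical_set_scope.
Local Open Scope ring_scope.

Set Implicit Arguments.
Unset Strict Implicit.
Unset Printing Implicit Defensive.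

(** Write e = x - w(u) for the distance of the plant to its steady state and
    phi = Phi o w for the reduced cost. The proof is a Lyapunov argument with

      V(x, u) = phi(u) - phi(us) + |G e|^2,

    where |G e|^2 is a quadratic Lyapunov function of the linearization of
    x' = f(x, us) at xs.

    - Such a form exists (hurwitz_quadratic_form) because global exponential
      stability for the constant input us forces every eigenvalue of the
      linearization to have a negative real part (exp_stable_hurwitz).

    - At (xs, us) we have f = 0 and h_r = beta^r h > 0, and the KKT conditions
      make the input velocity 0. So the state constraint of the quadratic
      program is slack nearby, and the controller is the projection of
      - eps p, p = (dw/du)^T grad Phi(x), on the half-space of the input
      constraint (QP_minimizerE). Its multiplier, hence the controller itself,
      depends continuously on (x, u) (halfspace_multiplier).

    - Along the closed loop, with input velocity q, the projection gives
      p.q <= - |q|^2 / eps where b >= 0 (slow_decrease). Replacing p by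
      grad phi(u) costs a multiple of |e||q|, and so does the motion of the
      steady state, while the plant contributes - c |e|^2 (coupling_bound).
      For small eps the squares absorb the cross terms, and V' <= - D with
      D = |q|^2 / (2 eps) + c |e|^2 / 2 (rate_arith).

    - If D vanishes at a nearby point with b >= 0, this point satisfies the
      KKT conditions of (P), so it is (xs, us). For the same reason us is a
      strict local minimizer of phi on b >= 0 (strict_local_min), so V is
      positive away from (xs, us).

    - The set b >= 0 is invariant (barrier_invariant), and the initial points
      in X_r belong to it. Stability and attractivity relative to this set
      follow by compactness (lyapunov_trap, lyapunov_attractive). Solutions
      that stay in a small ball exist for all times, by gluing the local ones
      (global_solution). *)

(** * Inner product and sup norm of columns *)

Section Vectors.
Context {R : realType}.

Lemma dotE d (a b : 'cV[R]_d) : dot a b = \sum_i a i 0 * b i 0.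
Proof. by rewrite /dot mxE; apply: eq_bigr => i _; rewrite mxE. Qed.

Lemma dotC d (a b : 'cV[R]_d) : dot a b = dot b a.
Proof. by rewrite !dotE; apply: eq_bigr => i _; rewrite mulrC. Qed.

Lemma dotDr d (a b c : 'cV[R]_d) : dot a (b + c) = dot a b + dot a c.
Proof. by rewrite /dot mulmxDr mxE. Qed.

Lemma dotNr d (a b : 'cV[R]_d) : dot a (- b) = - dot a b.
Proof. by rewrite /dot mulmxN mxE. Qed.

Lemma dotZr d k (a b : 'cV[R]_d) : dot a (k *: b) = k * dot a b.
Proof. by rewrite /dot -scalemxAr mxE. Qed.

Lemma dotDl d (a b c : 'cV[R]_d) : dot (a + b) c = dot a c + dot b c.
Proof. by rewrite !(dotC _ c) dotDr. Qed.

Lemma dotNl d (a b : 'cV[R]_d) : dot (- a) b = - dot a b.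
Proof. by rewrite !(dotC _ b) dotNr. Qed.

Lemma dotZl d k (a b : 'cV[R]_d) : dot (k *: a) b = k * dot a b.
Proof. by rewrite !(dotC _ b) dotZr. Qed.

Lemma dot0r d (a : 'cV[R]_d) : dot a 0 = 0.
Proof. by rewrite /dot mulmx0 mxE. Qed.

Lemma dot_mulmx d k (M : 'M[R]_(k, d)) a b : dot a (M *m b) = dot (M^T *m a) b.
Proof. by rewrite /dot trmx_mul trmxK mulmxA. Qed.

Lemma dot_col_mx d k (a a' : 'cV[R]_d) (b b' : 'cV[R]_k) :
  dot (col_mx a b) (col_mx a' b') = dot a a' + dot b b'.
Proof. by rewrite /dot tr_col_mx mul_row_col mxE. Qed.

Lemma dotxx_ge0 d (a : 'cV[R]_d) : 0 <= dot a a.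
Proof. by rewrite dotE sumr_ge0 // => i _; rewrite -expr2 sqr_ge0. Qed.

Lemma coord_le_norm d k (M : 'M[R]_(d, k)) i j : `|M i j| <= `|M|.
Proof.
rewrite [leRHS]/Num.Def.normr /= mx_normrE.
exact: (le_bigmax _ (fun ij => `|M ij.1 ij.2|) (i, j)).
Qed.

Lemma norm_le_coord d k (M : 'M[R]_(d, k)) c : 0 <= c ->
  (forall i j, `|M i j| <= c) -> `|M| <= c.
Proof.
move=> c0 Mc; rewrite [leLHS]/Num.Def.normr /= mx_normrE.
by apply: bigmax_le => // -[i j] _; exact: Mc.
Qed.

Lemma dot_le_norm d (a b : 'cV[R]_d) : `|dot a b| <= d%:R * (`|a| * `|b|).
Proof.
rewrite dotE (le_trans (ler_norm_sum _ _ _)) //.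
rewrite -[X in X%:R](card_ord d) mulr_natl -sumr_const ler_sum // => i _.
by rewrite normrM ler_pM // coord_le_norm.
Qed.

Lemma sqr_norm_le_dot d (a : 'cV[R]_d) : `|a| ^+ 2 <= dot a a.
Proof.
have le_sqrt : `|a| <= Num.sqrt (dot a a).
  apply: norm_le_coord => [|i j]; first exact: sqrtr_ge0.
  rewrite ord1 -sqrtr_sqr ler_sqrt ?dotxx_ge0 // dotE (bigD1 i) //= -expr2.
  by rewrite lerDl sumr_ge0 // => k _; rewrite -expr2 sqr_ge0.
by rewrite -(sqr_sqrtr (dotxx_ge0 a)) lerXn2r ?nnegrE ?sqrtr_ge0.
Qed.

Lemma dotxx_gt0 d (a : 'cV[R]_d) : a != 0 -> 0 < dot a a.
Proof.
move=> a0; apply: lt_le_trans (sqr_norm_le_dot a).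
by rewrite exprn_gt0 // normr_gt0.
Qed.

Lemma norm_mulmx_le d k (M : 'M[R]_(k, d)) (v : 'cV[R]_d) :
  `|M *m v| <= d%:R * (`|M| * `|v|).
Proof.
apply: norm_le_coord => [|i j]; first by rewrite !mulr_ge0.
rewrite mxE (le_trans (ler_norm_sum _ _ _)) //.
rewrite -[X in X%:R](card_ord d) mulr_natl -sumr_const ler_sum // => l _.
by rewrite normrM ler_pM // coord_le_norm.
Qed.

End Vectors.

(** * Derivatives along curves, gradients and partial derivatives *)

Section Derivatives.
Context {R : realType}.

(** Curves in a matrix space are differentiated entrywise; this reduces the
    mean value arguments below to real functions. *)
Lemma is_derive_mxP d k (z : R -> 'M[R]_(d, k)) t (v : 'M[R]_(d, k)) :
  is_derive t (1 : R) z v <->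
  forall i j, is_derive t (1 : R) (fun s => z s i j) (v i j).
Proof.
split=> [[dz <-] i j|dz].
  split; first by move/derivable_mxP: dz.
  by rewrite derive_mx // mxE.
have zt : derivable z t 1 by apply/derivable_mxP => i j; case: (dz i j).
split=> //; rewrite derive_mx //; apply/matrixP => i j; rewrite mxE.
by case: (dz i j).
Qed.

Lemma derive_grad d (g : 'cV[R]_d -> R) (y v : 'cV[R]_d) :
  differentiable g y -> 'D_v g y = dot (grad g y) v.
Proof.
move=> dg; rewrite deriveE // dotE.
have -> : v = \sum_i v i 0 *: delta_mx i 0.
  rewrite {1}(matrix_sum_delta v); apply: eq_bigr => i _.
  by rewrite big_ord1.
rewrite linear_sum /=; apply: eq_bigr => i _.
rewrite linearZ /= mxE deriveE // mulrC.
congr (_ * _); rewrite summxE (bigD1 i) //= !mxE !eqxx mulr1 big1 ?addr0 //.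
by move=> j ji; rewrite !mxE eq_sym (negbTE ji) mulr0.
Qed.

Lemma is_derive_comp_curve (V W : normedModType R) (g : V -> W) (z : R -> V)
    (t : R) (v : V) : differentiable g (z t) -> is_derive t (1 : R) z v ->
  is_derive t (1 : R) (fun s => g (z s)) ('D_v g (z t)).
Proof.
move=> dg [dz <-]; have dzt : differentiable z t by apply/derivable1_diffP.
have dgz : differentiable (g \o z) t by exact: differentiable_comp.
split; first exact: (@diff_derivable _ _ _ (g \o z)).
by rewrite (deriveE _ dgz) diff_comp //= -!deriveE.
Qed.

Lemma is_derive_grad d (g : 'cV[R]_d -> R) (z : R -> 'cV[R]_d) (t : R) v :
  differentiable g (z t) -> is_derive t (1 : R) z v ->
  is_derive t (1 : R) (fun s => g (z s)) (dot (grad g (z t)) v).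
Proof.
move=> dg dz; rewrite -derive_grad //.
exact: (@is_derive_comp_curve 'cV[R]_d R g z t v).
Qed.

Lemma derive_fst (V1 V2 W : normedModType R) (g : V1 * V2 -> W) x u v :
  'D_v (fun y => g (y, u)) x = 'D_((v, 0) : V1 * V2) g (x, u).
Proof.
rewrite /derive (_ : (fun h : R => _) = fun h : R =>
  h^-1 *: ((g \o shift (x, u)) (h *: ((v, 0) : V1 * V2)) - g (x, u))) //.
rewrite funeqE => s /=; congr (_ *: (g _ - _)).
by rewrite /GRing.add /GRing.scale /= /add_pair /scale_pair /= scaler0 add0r.
Qed.

Lemma derive_snd (V1 V2 W : normedModType R) (g : V1 * V2 -> W) x u v :
  'D_v (fun y => g (x, y)) u = 'D_((0, v) : V1 * V2) g (x, u).
Proof.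
rewrite /derive (_ : (fun h : R => _) = fun h : R =>
  h^-1 *: ((g \o shift (x, u)) (h *: ((0, v) : V1 * V2)) - g (x, u))) //.
rewrite funeqE => s /=; congr (_ *: (g _ - _)).
by rewrite /GRing.add /GRing.scale /= /add_pair /scale_pair /= scaler0 add0r.
Qed.

End Derivatives.

(** * Stability of C^k under algebraic operations *)

Section SmoothFunctions.
Context {R : realType}.
Implicit Types V W : normedModType R.

Lemma Ck_continuous V W k (g : V -> W) : Ck k g -> continuous g.
Proof.
case: k => [//|k] [dg _] x; exact: differentiable_continuous.
Qed.

Lemma CkW V W k (g : V -> W) : Ck k.+1 g -> Ck k g.
Proof.
elim: k g => [|k IHk] g; first exact: Ck_continuous.
by move=> [dg Dg]; split => // v; apply: IHk; exact: Dg.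
Qed.

Lemma Ck_le V W k l (g : V -> W) : (k <= l)%N -> Ck l g -> Ck k g.
Proof.
move=> /subnK <-; elim: (l - k)%N => [//|j IHj].
by rewrite addSn => /CkW.
Qed.

Lemma Ck_cst V W k (c : W) : Ck k (fun _ : V => c).
Proof.
elim: k c => [|k IHk] c /=; first by move=> x; exact: cvg_cst.
split=> [x|v]; first exact: differentiable_cst.
rewrite (_ : (fun x => 'D_v _ x) = fun=> 0); first exact: IHk.
by apply/funext => x; exact: derive_cst.
Qed.

Lemma CkD V W k (g1 g2 : V -> W) :
  Ck k g1 -> Ck k g2 -> Ck k (fun x => g1 x + g2 x).
Proof.
elim: k g1 g2 => [|k IHk] g1 g2 /=.
  by move=> c1 c2 x; apply: cvgD; [exact: c1|exact: c2].
move=> [d1 D1] [d2 D2]; split=> [x|v]; first exact: differentiableD.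
rewrite (_ : (fun x => 'D_v _ x) = fun x => 'D_v g1 x + 'D_v g2 x).
  exact: (IHk _ _ (D1 v) (D2 v)).
by apply/funext => x; apply: deriveD; exact: diff_derivable.
Qed.

Lemma Ck_sum V W k d (g : 'I_d -> V -> W) :
  (forall i, Ck k (g i)) -> Ck k (fun x => \sum_i g i x).
Proof.
elim: d g => [|d IHd] g Cg.
  by under eq_fun do rewrite big_ord0; exact: Ck_cst.
by under eq_fun do rewrite big_ord_recl; apply: CkD => //; exact: IHd.
Qed.

Lemma CkM V k (g1 g2 : V -> R) :
  Ck k g1 -> Ck k g2 -> Ck k (fun x => g1 x * g2 x).
Proof.
elim: k g1 g2 => [|k IHk] g1 g2.
  by move=> c1 c2 x; apply: cvgM; [exact: c1|exact: c2].
move=> C1 C2; have [[d1 D1] [d2 D2]] := (C1, C2).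
split=> [x|v]; first exact: differentiableM.
rewrite (_ : (fun x => 'D_v _ x) = fun x => g1 x * 'D_v g2 x + g2 x * 'D_v g1 x).
  apply: CkD; apply: IHk; [exact: CkW C1|exact: D2|exact: CkW C2|exact: D1].
by apply/funext => x; apply: deriveM; exact: diff_derivable.
Qed.

Lemma Ck_coord V k p q (g : V -> 'M[R]_(p, q)) i j :
  Ck k g -> Ck k (fun x => g x i j).
Proof.
elim: k g => [|k IHk] g.
  move=> cg x.
  exact: (continuous_comp (cg x) (@coord_continuous _ _ _ i j (g x))).
move=> [dg Dg]; split=> [x|v].
  exact: (differentiable_comp (dg x) (@differentiable_coord _ _ _ (g x) i j)).
rewrite (_ : (fun x => 'D_v _ x) = fun x => ('D_v g x) i j).
  exact: (IHk _ (Dg v)).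
by apply/funext => x; rewrite derive_mx ?mxE //; exact: diff_derivable.
Qed.

Lemma differentiable_fst V1 V2 (x : V1 * V2) :
  differentiable (fst : V1 * V2 -> V1) x.
Proof. by apply: linear_differentiable => y; exact: cvg_fst. Qed.

Lemma differentiable_snd V1 V2 (x : V1 * V2) :
  differentiable (snd : V1 * V2 -> V2) x.
Proof. by apply: linear_differentiable => y; exact: cvg_snd. Qed.

Lemma Ck_fst V1 V2 W k (g : V1 -> W) :
  Ck k g -> Ck k (fun z : V1 * V2 => g z.1).
Proof.
elim: k g => [|k IHk] g.
  by move=> cg x; apply: (continuous_comp (@cvg_fst _ _ _ _ _) (cg x.1)).
move=> [dg Dg]; split=> [x|v].
  exact: (differentiable_comp (@differentiable_fst _ _ x) (dg x.1)).
rewrite (_ : (fun x => 'D_v _ x) = fun x : V1 * V2 => ('D_(v.1) g x.1)).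
  exact: (IHk ('D_(v.1) g) (Dg v.1)).
by apply/funext => x.
Qed.

End SmoothFunctions.

(** * The barrier sequence h_i *)

Section SmoothGradients.
Context {R : realType} {n m : nat}.
Notation Z := ('cV[R]_n * 'cV[R]_m)%type.

Lemma grad_fstE (g : Z -> R) (z : Z) i :
  grad (fun x => g (x, z.2)) z.1 i 0 =
  'D_((delta_mx i 0, 0) : Z) g z.
Proof. by rewrite mxE derive_fst; case: z. Qed.

Lemma grad_sndE (g : Z -> R) (z : Z) i :
  grad (fun u => g (z.1, u)) z.2 i 0 =
  'D_((0, delta_mx i 0) : Z) g z.
Proof. by rewrite mxE derive_snd; case: z. Qed.

(** Each step of the recursion costs one derivative of h, and h_i stays below
    the regularity of f because i is at least 1 when f enters. *)
Lemma Ck_hseq (f : 'cV[R]_n -> 'cV[R]_m -> 'cV[R]_n) h beta r k :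
  Ck (r + k) (fun z : Z => f z.1 z.2) -> Ck (r + k.+1) h ->
  forall i, (i <= r)%N ->
  Ck (r - i + k.+1) (fun z : Z => hseq f h beta i z.1 z.2).
Proof.
move=> Cf Ch; elim=> [|i IHi] ir.
  by rewrite subn0; exact: Ck_fst.
have {IHi} := IHi (ltnW ir); rewrite -(subnSK ir) addSn => -[dh Dh].
have Ci : Ck (r - i.+1 + k.+1) (fun z : Z => hseq f h beta i z.1 z.2).
  by apply: CkW; split.
apply: CkD; last by apply: CkM => //; exact: Ck_cst.
under eq_fun do rewrite dotE.
apply: Ck_sum => j; apply: CkM.
  under eq_fun do rewrite (grad_fstE (fun z => hseq f h beta i z.1 z.2)).
  exact: Dh.
apply: Ck_coord; apply: Ck_le Cf.
by rewrite addnS -addSn leq_add2r subnSK // leq_subr.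
Qed.

(** At an equilibrium the Lie-derivative part vanishes, so h_r has the sign of
    h there. *)
Lemma hseq_equilibrium (f : 'cV[R]_n -> 'cV[R]_m -> 'cV[R]_n) h beta x u i :
  f x u = 0 -> hseq f h beta i x u = beta ^+ i * h x.
Proof.
move=> fxu0; elim: i => [|i IHi] /=; first by rewrite mul1r.
by rewrite fxu0 dot0r add0r IHi mulrA exprS.
Qed.

End SmoothGradients.

(** * Matrix-valued maps, Jacobians and the chain rule *)

Section MatrixSmoothness.
Context {R : realType}.

Lemma CkZl (V W : normedModType R) k (g : V -> R) (c : W) :
  Ck k g -> Ck k (fun x => g x *: c).
Proof.
elim: k g => [|k IHk] g; first by move=> cg x; apply: cvgZr_tmp; exact: cg.
move=> [dg Dg]; split=> [x|v]; first exact: differentiableZl.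
rewrite (_ : (fun x => 'D_v _ x) = fun x => 'D_v g x *: c).
  exact: (IHk _ (Dg v)).
by apply/funext => x; rewrite deriveE ?diffZl ?deriveE //; exact: differentiableZl.
Qed.

Lemma Ck_mx (V : normedModType R) k p q (g : V -> 'M[R]_(p, q)) :
  (forall i j, Ck k (fun x => g x i j)) -> Ck k g.
Proof.
move=> Cg.
have -> : g = fun x => \sum_i \sum_j g x i j *: delta_mx i j.
  by apply/funext => x; exact: matrix_sum_delta.
by apply: Ck_sum => i; apply: Ck_sum => j; exact: CkZl.
Qed.

Lemma Ck_grad d k (g : 'cV[R]_d -> R) : Ck k.+1 g -> Ck k (grad g).
Proof.
move=> [_ Dg]; apply: Ck_mx => i j.
by under eq_fun do rewrite mxE; exact: Dg.
Qed.

Lemma Ck_jac d p k (g : 'cV[R]_d -> 'cV[R]_p) : Ck k.+1 g -> Ck k (jac g).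
Proof.
move=> [_ Dg]; apply: Ck_mx => i j.
by under eq_fun do rewrite mxE; apply: Ck_coord; exact: Dg.
Qed.

Lemma Ck_snd (V1 V2 W : normedModType R) k (g : V2 -> W) :
  Ck k g -> Ck k (fun z : V1 * V2 => g z.2).
Proof.
elim: k g => [|k IHk] g.
  by move=> cg x; apply: (continuous_comp (@cvg_snd _ _ _ _ _) (cg x.2)).
move=> [dg Dg]; split=> [x|v].
  exact: (differentiable_comp (@differentiable_snd _ _ _ x) (dg x.2)).
rewrite (_ : (fun x => 'D_v _ x) = fun x : V1 * V2 => ('D_(v.2) g x.2)).
  exact: (IHk ('D_(v.2) g) (Dg v.2)).
by apply/funext => x.
Qed.

Lemma Ck_mulmx (V : normedModType R) k p q s (g1 : V -> 'M[R]_(p, q))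
    (g2 : V -> 'M[R]_(q, s)) : Ck k g1 -> Ck k g2 ->
  Ck k (fun x => g1 x *m g2 x).
Proof.
move=> C1 C2; apply: Ck_mx => i j; under eq_fun do rewrite mxE.
by apply: Ck_sum => l; apply: CkM; exact: Ck_coord.
Qed.

Lemma Ck_trmx (V : normedModType R) k p q (g : V -> 'M[R]_(p, q)) :
  Ck k g -> Ck k (fun x => (g x)^T).
Proof.
by move=> Cg; apply: Ck_mx => i j; under eq_fun do rewrite mxE; exact: Ck_coord.
Qed.

Lemma derive_jac d p (g : 'cV[R]_d -> 'cV[R]_p) (y v : 'cV[R]_d) :
  differentiable g y -> 'D_v g y = jac g y *m v.
Proof.
move=> dg; apply/colP => i; rewrite derive_mx ?mxE; last exact: diff_derivable.
have dgi : differentiable (fun x => g x i 0) y.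
  exact: (differentiable_comp dg (@differentiable_coord _ _ _ (g y) i 0)).
rewrite derive_grad // dotE; apply: eq_bigr => j _; rewrite !mxE.
by rewrite derive_mx ?mxE //; exact: diff_derivable.
Qed.

Lemma is_derive_jac d p (g : 'cV[R]_d -> 'cV[R]_p) (z : R -> 'cV[R]_d) (t : R) v :
  differentiable g (z t) -> is_derive t (1 : R) z v ->
  is_derive t (1 : R) (fun s => g (z s)) (jac g (z t) *m v).
Proof.
move=> dg dz; rewrite -(derive_jac v dg).
exact: (@is_derive_comp_curve _ 'cV[R]_d 'cV[R]_p g z t v).
Qed.

Lemma grad_comp d p (g : 'cV[R]_p -> R) (k : 'cV[R]_d -> 'cV[R]_p) y :
  differentiable k y -> differentiable g (k y) ->
  grad (fun x => g (k x)) y = (jac k y)^T *m grad g (k y).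
Proof.
move=> dk dg; apply/colP => i; rewrite !mxE.
have dgk : differentiable (g \o k) y by exact: differentiable_comp.
rewrite (deriveE _ dgk) diff_comp //= -!deriveE // derive_grad // dotC dotE.
by apply: eq_bigr => j _; rewrite !mxE.
Qed.

End MatrixSmoothness.

(** * Weighted dissipation of triangular systems *)

Section TriangularForm.
Context {R : realType}.

(** T1 and T2 are the real and imaginary parts of a lower triangular complex
    matrix T, and a, b those of a complex vector y; the left-hand side is the
    real part of conj(y_i) (T y)_i. The diagonal entry gives decay, and the
    entries below it only involve the y_j with j < i, which Young's inequality
    separates from y_i. *)
Lemma row_dissipation (n : nat) (T1 T2 : 'M[R]_n) (kappa : R) :
  (forall i j : 'I_n, (i < j)%N -> T1 i j = 0 /\ T2 i j = 0) ->
  0 < kappa -> (forall i, T1 i i <= - kappa) ->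
  exists2 C : R, 0 <= C & forall (a b : 'cV[R]_n) i,
    a i 0 * (T1 *m a - T2 *m b) i 0 + b i 0 * (T1 *m b + T2 *m a) i 0
    <= - (kappa / 2) * (a i 0 ^+ 2 + b i 0 ^+ 2)
       + C * \sum_(j < n | (j < i)%N) (a j 0 ^+ 2 + b j 0 ^+ 2).
Proof.
move=> Ttrig kappa0 Tdiag.
pose M := `|T1| + `|T2|; pose s := kappa / (2 * (n%:R * M + 1)).
have M0 : 0 <= M by rewrite addr_ge0.
have nM0 : 0 < n%:R * M + 1 by rewrite ltr_wpDl // mulr_ge0.
have s0 : 0 < s by rewrite divr_gt0 // mulr_gt0.
have MT i j : `|T1 i j| <= M /\ `|T2 i j| <= M.
  by rewrite /M; have := coord_le_norm T1 i j; have := coord_le_norm T2 i j;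
     have := normr_ge0 T1; have := normr_ge0 T2; split; lra.
have nMs : n%:R * M * s <= kappa / 2.
  rewrite (_ : kappa / 2 = (n%:R * M + 1) * s).
    by rewrite ler_wpM2r ?ltW // ltrDl.
  by rewrite /s; field; rewrite lt0r_neq0.
clearbody s; exists (M / s) => [|a b i]; first by rewrite divr_ge0 // ltW.
pose Q j := a j 0 ^+ 2 + b j 0 ^+ 2.
have Q0 j : 0 <= Q j by rewrite addr_ge0 // sqr_ge0.
(* Young's inequality with parameter s on each off-diagonal product; the value
   of s makes n such terms cost at most half of kappa. *)
have young (t x y : R) : `|t| <= M ->
    t * (x * y) <= M / 2 * (s * x ^+ 2 + y ^+ 2 / s).
  move=> tM; apply: le_trans (_ : M * `|x * y| <= _).
    by rewrite (le_trans (ler_norm _)) // normrM ler_wpM2r.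
  rewrite -mulrA ler_wpM2l // normrM.
  have : 0 <= (s * `|x| - `|y|) ^+ 2 / s by rewrite divr_ge0 ?sqr_ge0 ?ltW.
  have -> : (s * `|x| - `|y|) ^+ 2 / s =
      s * `|x| ^+ 2 + `|y| ^+ 2 / s - 2 * (`|x| * `|y|).
    by field; rewrite lt0r_neq0.
  by rewrite !real_normK ?num_real //; lra.
pose F j := a i 0 * (T1 i j * a j 0 - T2 i j * b j 0)
          + b i 0 * (T1 i j * b j 0 + T2 i j * a j 0).
have -> : a i 0 * (T1 *m a - T2 *m b) i 0 + b i 0 * (T1 *m b + T2 *m a) i 0
    = \sum_j F j.
  rewrite !mxE -sumrN -!big_split /= !mulr_sumr -big_split.
  by apply: eq_bigr => j _.
have Fi : F i <= - kappa * Q i.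
  have -> : F i = T1 i i * Q i by rewrite /F /Q; ring.
  by rewrite ler_wpM2r.
have Fj (j : 'I_n) : (j < i)%N -> F j <= M * (s * Q i + Q j / s).
  move=> ji; have [m1 m2] := MT i j.
  have -> : F j = T1 i j * (a i 0 * a j 0) + (- T2 i j) * (a i 0 * b j 0)
    + (T1 i j * (b i 0 * b j 0) + T2 i j * (b i 0 * a j 0)).
    by rewrite /F; ring.
  have y1 := young _ (a i 0) (a j 0) m1.
  have := m2; rewrite -normrN => m2'.
  have y2 := young _ (a i 0) (b j 0) m2'.
  have y3 := young _ (b i 0) (b j 0) m1.
  have y4 := young _ (b i 0) (a j 0) m2.
  rewrite (_ : M * _ = M / 2 * (s * a i 0 ^+ 2 + a j 0 ^+ 2 / s)
    + M / 2 * (s * a i 0 ^+ 2 + b j 0 ^+ 2 / s)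
    + (M / 2 * (s * b i 0 ^+ 2 + b j 0 ^+ 2 / s)
    + M / 2 * (s * b i 0 ^+ 2 + a j 0 ^+ 2 / s))); first by lra.
  by rewrite /Q; field; rewrite lt0r_neq0.
have Fj0 (j : 'I_n) : (i < j)%N -> F j = 0.
  by move=> ij; rewrite /F; have [-> ->] := Ttrig _ _ ij; ring.
rewrite (bigD1 i) //= (bigID (fun j : 'I_n => (j < i)%N)) /=.
rewrite [X in _ + (_ + X)]big1 ?addr0; last first.
  by move=> j /andP[ji]; rewrite -leqNgt => ij; apply: Fj0;
     rewrite ltn_neqAle ij andbT eq_sym.
rewrite (eq_bigl (fun j : 'I_n => (j < i)%N)); last first.
  by move=> j; case: eqVneq => [->|]; rewrite ?ltnn.
have : \sum_(j < n | (j < i)%N) F j <=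
    n%:R * M * s * Q i + M / s * \sum_(j < n | (j < i)%N) Q j.
  apply: le_trans (ler_sum _ (fun j ji => Fj j ji)) _.
  rewrite -mulr_sumr big_split /= mulrDr -[X in _ + M * X]mulr_suml.
  rewrite lerD //; last by rewrite mulrCA mulrC.
  rewrite sumr_const -[_ *+ _]mulr_natl !mulrA ler_wpM2r // ler_wpM2r ?(ltW s0) //.
  rewrite mulrC ler_wpM2r // ler_nat.
  by rewrite (leq_trans (max_card _)) // card_ord.
have : n%:R * M * s * Q i <= kappa / 2 * Q i by rewrite ler_wpM2r.
rewrite -/(Q i); lra.
Qed.

(** The geometric weights d_i = t^i make each row dominated by the decay of
    the rows above it: the error that |y_j|^2 causes in the rows i > j is
    weighted by d_i <= t d_j. *)
Lemma triangular_dissipation (n : nat) (T1 T2 : 'M[R]_n) :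
  (forall i j : 'I_n, (i < j)%N -> T1 i j = 0 /\ T2 i j = 0) ->
  (forall i, T1 i i < 0) ->
  exists (d : 'I_n -> R) (c : R), [/\ 0 < c, forall i, 0 < d i &
    forall a b : 'cV[R]_n,
    \sum_i d i * (a i 0 * (T1 *m a - T2 *m b) i 0
                  + b i 0 * (T1 *m b + T2 *m a) i 0)
    <= - c * \sum_i d i * (a i 0 ^+ 2 + b i 0 ^+ 2)].
Proof.
move=> Ttrig Tdiag.
have [kappa kappa0 Tk] : exists2 kappa : R, 0 < kappa &
    forall i, T1 i i <= - kappa.
  exists (\big[Num.min/1]_i (- T1 i i)).
    elim/big_ind: _ => // [x y x0 y0|i _]; first by rewrite lt_min x0.
    by rewrite oppr_gt0.
  by move=> i; rewrite lerNr; exact: bigmin_le_cond.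
have [C C0 HC] := row_dissipation Ttrig kappa0 Tk.
(* t <= 1 and C n t <= kappa / 4: the at most n rows below a given one absorb
   a quarter of kappa. *)
pose t := kappa / (kappa + 4 * (C * n%:R + 1)).
have Cn0 : 0 <= C * n%:R by rewrite mulr_ge0.
have den0 : 0 < kappa + 4 * (C * n%:R + 1) by lra.
have t0 : 0 < t by rewrite divr_gt0.
have t1 : t <= 1 by rewrite ler_pdivrMr //; lra.
have Cnt : C * n%:R * t <= kappa / 4.
  rewrite /t mulrA ler_pdivrMr //.
  have : 0 <= kappa / 4 * kappa + kappa by nra.
  lra.
exists (fun i => t ^+ i), (kappa / 4); split => [|i|a b].
- by rewrite divr_gt0.
- by rewrite exprn_gt0.
pose Q j := a j 0 ^+ 2 + b j 0 ^+ 2.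
have Q0 j : 0 <= Q j by rewrite addr_ge0 // sqr_ge0.
apply: le_trans (_ : \sum_(i < n) t ^+ i * (- (kappa / 2) * Q i
    + C * \sum_(j < n | (j < i)%N) Q j) <= _).
  by apply: ler_sum => i _; rewrite ler_wpM2l ?exprn_ge0 ?(ltW t0).
have -> : \sum_(i < n) t ^+ i * (- (kappa / 2) * Q i
      + C * \sum_(j < n | (j < i)%N) Q j) =
    - (kappa / 2) * \sum_(i < n) t ^+ i * Q i
    + \sum_(j < n) \sum_(i < n | (j < i)%N) C * (t ^+ i * Q j).
  under eq_bigr do rewrite mulrDr.
  rewrite big_split /= mulr_sumr; congr (_ + _).
    by apply: eq_bigr => i _; ring.
  rewrite (exchange_big_dep predT) //=; apply: eq_bigr => i _.
  by rewrite !mulr_sumr; apply: eq_bigr => j _; ring.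
have : \sum_(j < n) \sum_(i < n | (j < i)%N) C * (t ^+ i * Q j) <=
    \sum_(j < n) kappa / 4 * (t ^+ j * Q j).
  apply: ler_sum => j _.
  apply: le_trans (_ : \sum_(i < n | (j < i)%N) C * (t * (t ^+ j * Q j)) <= _).
    apply: ler_sum => i ji; rewrite ler_wpM2l // mulrA ler_wpM2r // -exprS.
    by rewrite ler_wiXn2l // ltW.
  have tQ0 : 0 <= t ^+ j * Q j by rewrite mulr_ge0 // exprn_ge0 // ltW.
  rewrite sumr_const -[_ *+ _]mulr_natl.
  apply: le_trans (_ : n%:R * (C * (t * (t ^+ j * Q j))) <= _).
    rewrite ler_wpM2r //; first by rewrite mulr_ge0 // mulr_ge0 // ltW.
    by rewrite ler_nat (leq_trans (max_card _)) // card_ord.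
  rewrite (_ : n%:R * _ = C * n%:R * t * (t ^+ j * Q j)); last by ring.
  by rewrite ler_wpM2r.
rewrite -mulr_sumr /Q; lra.
Qed.

End TriangularForm.

(** * A quadratic Lyapunov function for a Hurwitz matrix *)

Section ComplexMatrices.
Context {R : realType}.
Local Notation Re := (@complex.Re R).
Local Notation Im := (@complex.Im R).

Lemma ReM (x y : R[i]) : Re (x * y) = Re x * Re y - Im x * Im y.
Proof. by case: x; case: y. Qed.

Lemma ImM (x y : R[i]) : Im (x * y) = Re x * Im y + Im x * Re y.
Proof. by case: x; case: y. Qed.

Lemma Re_sum (I : finType) (F : I -> R[i]) : Re (\sum_i F i) = \sum_i Re (F i).
Proof.
have ReD : {morph Re : x y / x + y} by case=> a b [c d].
exact: (big_morph _ ReD).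
Qed.

Lemma Im_sum (I : finType) (F : I -> R[i]) : Im (\sum_i F i) = \sum_i Im (F i).
Proof.
have ImD : {morph Im : x y / x + y} by case=> a b [c d].
exact: (big_morph _ ImD).
Qed.

Notation ReMx := (map_mx (Re)).
Notation ImMx := (map_mx (Im)).

Lemma ReMx_mul p q s (M : 'M[R[i]]_(p, q)) (N : 'M[R[i]]_(q, s)) :
  ReMx (M *m N) = ReMx M *m ReMx N - ImMx M *m ImMx N.
Proof.
apply/matrixP => i j; rewrite !mxE Re_sum -sumrN -big_split.
by apply: eq_bigr => k _; rewrite !mxE ReM.
Qed.

Lemma ImMx_mul p q s (M : 'M[R[i]]_(p, q)) (N : 'M[R[i]]_(q, s)) :
  ImMx (M *m N) = ReMx M *m ImMx N + ImMx M *m ReMx N.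
Proof.
apply/matrixP => i j; rewrite !mxE Im_sum -big_split.
by apply: eq_bigr => k _; rewrite !mxE ImM.
Qed.

Lemma ReMx_real p q (M : 'M[R]_(p, q)) : ReMx (map_mx (real_complex R) M) = M.
Proof. by apply/matrixP => i j; rewrite !mxE. Qed.

Lemma ImMx_real p q (M : 'M[R]_(p, q)) : ImMx (map_mx (real_complex R) M) = 0.
Proof. by apply/matrixP => i j; rewrite !mxE. Qed.

Lemma mx_complex_eq0 p q (M : 'M[R[i]]_(p, q)) :
  ReMx M = 0 -> ImMx M = 0 -> M = 0.
Proof.
move=> /matrixP Re0 /matrixP Im0; apply/matrixP => i j.
have := Re0 i j; have := Im0 i j; rewrite !mxE.
by case: (M i j) => a b /= -> ->.
Qed.

(** The hypothesis says, in real terms, that every eigenvalue a + i b of A has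
    a negative real part, with left eigenvector l1 + i l2. The conclusion is
    the Schur triangularization T P = P A over R[i], split into real and
    imaginary parts. *)
Lemma real_Schur n (A : 'M[R]_n) :
  (forall (a b : R) (l1 l2 : 'rV[R]_n), (l1 != 0) || (l2 != 0) ->
     l1 *m A = a *: l1 - b *: l2 -> l2 *m A = b *: l1 + a *: l2 -> a < 0) ->
  exists P1 P2 T1 T2 : 'M[R]_n,
  [/\ forall i j : 'I_n, (i < j)%N -> T1 i j = 0 /\ T2 i j = 0,
      forall i, T1 i i < 0,
      P1 *m A = T1 *m P1 - T2 *m P2 /\ P2 *m A = T1 *m P2 + T2 *m P1 &
      forall e : 'cV[R]_n, P1 *m e = 0 -> P2 *m e = 0 -> e = 0].
Proof.
move=> stableA; case: (posnP n) => [n0|n0].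
  move: A stableA; rewrite n0 => A _; exists 0, 0, 0, 0; split.
  - by case.
  - by case.
  - by rewrite !mul0mx subr0 addr0.
  - by move=> e _ _; apply/matrixP => -[].
pose AC := map_mx (real_complex R) A.
have [P Punitary Ptrig] := Schur AC n0.
have Pu := unitarymx_unit Punitary.
pose T := P *m AC *m invmx P.
have TP : P *m AC = T *m P by rewrite /T mulmxKV.
have Ttrig : is_trig_mx T by rewrite /T -conjumx.
clearbody T; exists (ReMx P), (ImMx P), (ReMx T), (ImMx T); split.
- by move=> i j ij; rewrite !mxE; have /is_trig_mxP/(_ _ _ ij) -> := Ttrig.
- move=> i; rewrite mxE.
  have : eigenvalue AC (T i i).
    have : eigenvalue T (T i i).
      rewrite eigenvalue_root_char char_poly_trig // /root horner_prod.
      by apply/eqP; rewrite (bigD1 i) //= !hornerE subrr mul0r.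
    case/eigenvalueP => v Tv v0; apply/eigenvalueP; exists (v *m P).
      by rewrite -mulmxA TP mulmxA Tv -scalemxAl.
    by apply: contraNneq v0 => vP0; rewrite -(mulmxK Pu v) vP0 mul0mx.
  case/eigenvalueP => v vA v0; have := stableA _ (Im (T i i)) (ReMx v) (ImMx v).
  apply.
  + have [/eqP|//] := boolP (ReMx v == 0) => Re0 /=.
    by apply: contraNneq v0 => Im0; apply/eqP; exact: mx_complex_eq0.
  + have := congr1 (fun M : 'rV_n => ReMx M) vA.
    rewrite ReMx_mul ReMx_real ImMx_real mulmx0 subr0 => ->.
    by apply/rowP => j; rewrite !mxE ReM.
  + have := congr1 (fun M : 'rV_n => ImMx M) vA.
    rewrite ImMx_mul ReMx_real ImMx_real mulmx0 add0r => ->.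
    by apply/rowP => j; rewrite !mxE ImM addrC.
- have := congr1 (fun M : 'M[R[i]]_n => ReMx M) TP.
  have := congr1 (fun M : 'M[R[i]]_n => ImMx M) TP.
  rewrite !ReMx_mul !ImMx_mul ReMx_real ImMx_real !mulmx0 subr0 add0r.
  by move=> -> ->.
- move=> e e1 e2; pose eC := map_mx (real_complex R) e.
  have PeC : P *m eC = 0.
    apply: mx_complex_eq0.
      by rewrite ReMx_mul ReMx_real ImMx_real mulmx0 subr0.
    by rewrite ImMx_mul ReMx_real ImMx_real mulmx0 add0r.
  have eC0 : eC = 0 by rewrite -(mulKmx Pu eC) PeC mulmx0.
  have := congr1 (fun M : 'cV_n => ReMx M) eC0.
  by rewrite ReMx_real => ->; apply/matrixP => i j; rewrite !mxE.
Qed.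

(** An injective linear map has a left inverse, whose norm gives the
    constant. *)
Lemma injective_lower_bound k n (G : 'M[R]_(k, n)) :
  (forall e : 'cV[R]_n, G *m e = 0 -> e = 0) ->
  exists2 c : R, 0 < c & forall e : 'cV[R]_n,
    c * `|e| ^+ 2 <= dot (G *m e) (G *m e).
Proof.
move=> Ginj; have : row_free G^T.
  rewrite -kermx_eq0; apply/rowV0P => u /sub_kermxP uG.
  apply: trmx_inj; rewrite trmx0; apply: Ginj.
  by rewrite -[G]trmxK -trmx_mul uG trmx0.
case/row_freeP => B GB; pose K := k%:R * `|B^T|.
have K0 : 0 <= K by rewrite mulr_ge0.
exists (K ^+ 2 + 1)^-1 => [|e]; first by rewrite invr_gt0 ltr_wpDl ?sqr_ge0.
rewrite ler_pdivrMl ?ltr_wpDl ?sqr_ge0 //.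
have eE : `|e| <= K * `|G *m e|.
  rewrite {1}(_ : e = B^T *m (G *m e)); last first.
    by rewrite mulmxA -[G]trmxK -trmx_mul GB trmx1 mul1mx.
  by rewrite (le_trans (norm_mulmx_le _ _)) // mulrA.
have : `|e| ^+ 2 <= K ^+ 2 * `|G *m e| ^+ 2.
  by rewrite -exprMn lerXn2r ?nnegrE // mulr_ge0.
have := sqr_norm_le_dot (G *m e); have := sqr_ge0 K; nra.
Qed.

(** The quadratic form e |-> |G e|^2 is a Lyapunov function of e' = A e: it is
    the weighted Euclidean norm of the coordinates in which A is
    triangular. *)
Lemma hurwitz_quadratic_form n (A : 'M[R]_n) :
  (forall (a b : R) (l1 l2 : 'rV[R]_n), (l1 != 0) || (l2 != 0) ->
     l1 *m A = a *: l1 - b *: l2 -> l2 *m A = b *: l1 + a *: l2 -> a < 0) ->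
  exists (G : 'M[R]_(n + n, n)) (c : R), 0 < c /\ forall e : 'cV[R]_n,
    dot (G *m e) (G *m (A *m e)) <= - c * `|e| ^+ 2 /\
    c * `|e| ^+ 2 <= dot (G *m e) (G *m e).
Proof.
move=> /real_Schur [P1 [P2 [T1 [T2 [Ttrig Tdiag [P1A P2A] Pinj]]]]].
have [d [c [c0 d0 Hd]]] := triangular_dissipation Ttrig Tdiag.
pose D := diag_mx (\row_i Num.sqrt (d i)).
pose G := col_mx (D *m P1) (D *m P2).
have DE (v : 'cV[R]_n) i : (D *m v) i 0 = Num.sqrt (d i) * v i 0.
  by rewrite mul_diag_mx !mxE.
have dotD (v v' : 'cV[R]_n) :
    dot (D *m v) (D *m v') = \sum_i d i * (v i 0 * v' i 0).
  rewrite dotE; apply: eq_bigr => i _; rewrite !DE mulrACA -expr2 sqr_sqrtr //.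
  exact: ltW.
have dotG (e e' : 'cV[R]_n) : dot (G *m e) (G *m e') =
    \sum_i d i * ((P1 *m e) i 0 * (P1 *m e') i 0
                  + (P2 *m e) i 0 * (P2 *m e') i 0).
  rewrite /G !mul_col_mx dot_col_mx -!mulmxA !dotD -big_split /=.
  by apply: eq_bigr => i _; rewrite mulrDr.
have Ginj (e : 'cV[R]_n) : G *m e = 0 -> e = 0.
  rewrite /G mul_col_mx -[0]vsubmxK => /eq_col_mx.
  rewrite !linear0 -!mulmxA => -[D1 D2].
  have Dinj (v : 'cV[R]_n) : D *m v = 0 -> v = 0.
    move=> Dv; apply/colP => i; rewrite mxE.
    have := DE v i; rewrite Dv mxE => /esym/eqP.
    by rewrite mulf_eq0 gt_eqF ?sqrtr_gt0 //= => /eqP.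
  by apply: Pinj; exact: Dinj.
have [c' c'0 Hc'] := injective_lower_bound Ginj.
exists G, (Num.min c' (c * c')); split; first by rewrite lt_min c'0 mulr_gt0.
have mc1 : Num.min c' (c * c') <= c' by rewrite ge_min lexx.
have mc2 : Num.min c' (c * c') <= c * c' by rewrite ge_min lexx orbT.
move=> e; split; last first.
  by apply: le_trans (Hc' e); rewrite ler_wpM2r ?sqr_ge0.
have := Hd (P1 *m e) (P2 *m e).
rewrite !mulmxA -!mulmxBl -!mulmxDl -P1A -P2A.
under eq_bigr do rewrite -!mulmxA.
rewrite -dotG -mulmxA => /le_trans; apply.
have -> : \sum_i d i * ((P1 *m e) i 0 ^+ 2 + (P2 *m e) i 0 ^+ 2) =
    dot (G *m e) (G *m e).
  by rewrite dotG; apply: eq_bigr => i _; rewrite !expr2.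
have := Hc' e; have := sqr_ge0 `|e|; nra.
Qed.

End ComplexMatrices.

(** * Increments of functions along curves *)

Section CurveCalculus.
Context {R : realType}.

Lemma is_derive_line (V : normedModType R) (x v : V) (s : R) :
  is_derive s (1 : R) (fun s : R => x + s *: v) v.
Proof.
have dscale : differentiable (fun s : R => s *: v) s by exact: ex_diff.
have d1 : is_derive s (1 : R) (fun s : R => s *: v) v.
  split; first by apply/derivable1_diffP.
  by rewrite deriveE // diff_val scale1r.
have := @is_deriveD _ _ _ (cst x) _ s 1 _ _ (is_derive_cst x s 1) d1.
by rewrite add0r.
Qed.

Lemma is_derive_dotr d (l : 'cV[R]_d) (z : R -> 'cV[R]_d) t v :
  is_derive t (1 : R) z v ->
  is_derive t (1 : R) (fun s => dot l (z s)) (dot l v).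
Proof.
move=> /is_derive_mxP dz.
have -> : (fun s => dot l (z s)) = \sum_i (fun s => l i 0 * z s i 0).
  by apply/funext => s; rewrite dotE fct_sumE.
by rewrite dotE; apply: is_derive_sum.
Qed.

Lemma is_derive_mulmx d k (M : 'M[R]_(k, d)) (z : R -> 'cV[R]_d) t v :
  is_derive t (1 : R) z v ->
  is_derive t (1 : R) (fun s => M *m z s) (M *m v).
Proof.
move=> dz; apply/is_derive_mxP => i j; rewrite ord1.
have E (y : 'cV[R]_d) : (M *m y) i 0 = dot (row i M)^T y.
  by rewrite mxE dotE; apply: eq_bigr => l _; rewrite !mxE.
by rewrite E; under eq_fun do rewrite E; exact: is_derive_dotr.
Qed.

Lemma is_derive_sqr (g : R -> R) t v : is_derive t (1 : R) g v ->
  is_derive t (1 : R) (fun s => g s ^+ 2) (2 * (g t * v)).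
Proof.
move=> dg; rewrite (_ : (fun s => g s ^+ 2) = g * g); last first.
  by apply/funext => s; rewrite expr2.
apply: (is_derive_eq (@is_deriveM _ _ g g t 1 v v dg dg)).
by rewrite /GRing.scale /=; ring.
Qed.

Lemma is_derive_dotxx d (z : R -> 'cV[R]_d) t v : is_derive t (1 : R) z v ->
  is_derive t (1 : R) (fun s => dot (z s) (z s)) (2 * dot (z t) v).
Proof.
move=> /is_derive_mxP dz.
have -> : (fun s => dot (z s) (z s)) = \sum_i (fun s => z s i 0 ^+ 2).
  by apply/funext => s; rewrite dotE fct_sumE; apply: eq_bigr => i _;
     rewrite expr2.
rewrite dotE mulr_sumr; apply: is_derive_sum => i.
exact: is_derive_sqr.
Qed.

Lemma is_derive_continuous (V : normedModType R) (z : R -> V) t v :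
  is_derive t (1 : R) z v -> {for t, continuous z}.
Proof. by case=> /derivable1_diffP/differentiable_continuous. Qed.

(** The mean value theorem, in the form that integrates differential
    inequalities along solutions. *)
Lemma derive_ge_increment (g g' : R -> R) (a b c : R) : a <= b ->
  (forall t, a <= t <= b -> is_derive t (1 : R) g (g' t)) ->
  (forall t, a <= t <= b -> c <= g' t) -> c * (b - a) <= g b - g a.
Proof.
move=> ab dg g'c.
have [t tab ->] : exists2 t, t \in `[a, b]%R & g b - g a = g' t * (b - a).
  apply: MVT_segment => // [t|].
    by rewrite in_itv /= => /andP[/ltW at_ /ltW tb]; apply: dg; rewrite at_.
  apply: continuous_in_subspaceT => t; rewrite inE /= in_itv /= => tab.
  exact: is_derive_continuous (dg t tab).
rewrite ler_wpM2r ?subr_ge0 //; apply: g'c.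
by move: tab; rewrite in_itv.
Qed.

Lemma derive_le_increment (g g' : R -> R) (a b c : R) : a <= b ->
  (forall t, a <= t <= b -> is_derive t (1 : R) g (g' t)) ->
  (forall t, a <= t <= b -> g' t <= c) -> g b - g a <= c * (b - a).
Proof.
move=> ab dg g'c.
have := @derive_ge_increment (fun s => - g s) (fun s => - g' s) a b (- c) ab.
rewrite mulNr -opprD lerN2; apply => t tab.
  by have dgt := dg t tab; exact: is_deriveN.
by rewrite lerN2 g'c.
Qed.

End CurveCalculus.

Lemma differentiable_slice {R : realType} (V1 V2 W : normedModType R)
    (g : V1 * V2 -> W) x u :
  differentiable g (x, u) -> differentiable (fun y => g (y, u)) x.
Proof.
move=> dg.
have dxu : differentiable (fun y : V1 => (y, u)) x.
  by apply: (@differentiable_pair _ _ _ _ id (cst u)); apply: ex_diff.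
exact: (differentiable_comp dxu dg).
Qed.

(** * Strict differentiability of C^1 maps *)

Section StrictDifferentiability.
Context {R : realType} {n m : nat}.
Notation Z := ('cV[R]_n * 'cV[R]_m)%type.

(** A C^1 function is strictly differentiable: on a small convex ball the
    partial gradient in x stays within eta of its value at z0, and the mean
    value theorem on the segment from x' to x turns this into an estimate that
    is uniform in u. *)
Lemma strict_grad_fst (g : Z -> R) (z0 : Z) (eta : R) : Ck 1 g -> 0 < eta ->
  \forall rho \near 0^'+, forall x x' u, `|x - z0.1| < rho ->
    `|x' - z0.1| < rho -> `|u - z0.2| < rho ->
    `|g (x, u) - g (x', u)
      - dot (grad (fun y => g (y, z0.2)) z0.1) (x - x')| <= eta * `|x - x'|.
Proof.
move=> [dg Dg] eta0.
have n0 : 0 < eta / (n%:R + 1) by rewrite divr_gt0 // ltr_wpDl.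
have [rho0 rho00 Hrho] : exists2 rho : R, 0 < rho & forall z : Z,
    `|z.1 - z0.1| < rho -> `|z.2 - z0.2| < rho -> forall i : 'I_n,
    `|'D_((delta_mx i 0, 0) : Z) g z0 - 'D_((delta_mx i 0, 0) : Z) g z|
    <= eta / (n%:R + 1).
  pose close (i : 'I_n) (z : Z) :=
    `|'D_((delta_mx i 0, 0) : Z) g z0 - 'D_((delta_mx i 0, 0) : Z) g z|
    <= eta / (n%:R + 1).
  have : \forall z \near z0, forall i, close i z.
    have F0 : Filter (nbhs z0) by exact: nbhs_filter.
    refine (@filter_forall Z _ close (nbhs z0) F0 _) => i.
    by move/cvgrPdist_le : (Dg ((delta_mx i 0, 0) : Z) z0) => /(_ _ n0).
  case/nbhs_ballP => rho /= rho0 sub; exists rho => // z z1 z2; apply: sub.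
  by split; rewrite -ball_normE /= distrC.
near=> rho => x x' u xr x'r ur.
have rr0 : rho <= rho0 by near: rho; exact: nbhs_right_le.
set l := grad _ _; set d := x - x'.
pose y s := x' + s *: d.
have dy s : is_derive s (1 : R) y d by exact: is_derive_line.
pose G s := g (y s, u) - dot l (y s).
pose G' s := dot (grad (fun x => g (x, u)) (y s) - l) d.
have yr s : 0 <= s <= 1 -> `|y s - z0.1| < rho.
  move=> /andP[s0 s1].
  have -> : y s - z0.1 = (1 - s) *: (x' - z0.1) + s *: (x - z0.1).
    by rewrite /y /d; apply/matrixP => i j; rewrite !mxE; ring.
  have [->|sn0] := eqVneq s 0; first by rewrite subr0 scale1r scale0r addr0.
  have sgt0 : 0 < s by rewrite lt_neqAle eq_sym sn0.
  rewrite (le_lt_trans (ler_normD _ _)) // !normrZ !ger0_norm ?subr_ge0 //.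
  have : s * `|x - z0.1| < s * rho by rewrite ltr_pM2l.
  have : (1 - s) * `|x' - z0.1| <= (1 - s) * rho.
    by rewrite ler_wpM2l ?subr_ge0 // ltW.
  lra.
have dG s : is_derive s (1 : R) G (G' s).
  have dgu : differentiable (fun x => g (x, u)) (y s).
    exact: differentiable_slice.
  have d1 := is_derive_grad dgu (dy s).
  have d2 := is_derive_dotr l (dy s).
  by rewrite /G' dotDl dotNl; exact: is_deriveB.
have G'le s : 0 <= s <= 1 -> `|G' s| <= eta * `|d|.
  move=> s01; rewrite (le_trans (dot_le_norm _ _)) // mulrA ler_wpM2r //.
  apply: le_trans (_ : n%:R * (eta / (n%:R + 1)) <= _).
    rewrite ler_wpM2l //; apply: norm_le_coord => [|i j]; first exact: ltW.
    rewrite ord1 /l !mxE !derive_fst -surjective_pairing distrC.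
    by apply: Hrho => /=; [rewrite (lt_le_trans (yr s s01))
      | rewrite (lt_le_trans ur)].
  rewrite mulrCA ger_pMr // ler_pdivrMr ?ltr_wpDl // mul1r; lra.
have y1 : y 1 = x by rewrite /y scale1r /d addrC subrK.
have y0 : y 0 = x' by rewrite /y scale0r addr0.
have -> : g (x, u) - g (x', u) - dot l d = G 1 - G 0.
  by rewrite /G y1 y0 /d dotDr dotNr; ring.
have up := @derive_le_increment _ G G' 0 1 (eta * `|d|) ler01
  (fun s _ => dG s).
have lo := @derive_ge_increment _ G G' 0 1 (- (eta * `|d|)) ler01
  (fun s _ => dG s).
rewrite subr0 !mulr1 in up lo; rewrite ler_norml lo ?up // => s s01.
  by have := G'le s s01; rewrite ler_norml => /andP[].
by have := G'le s s01; rewrite ler_norml => /andP[].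
Unshelve. all: by end_near. Qed.

Lemma strict_jac_fst k (g : Z -> 'cV[R]_k) (z0 : Z) (eta : R) :
  Ck 1 g -> 0 < eta ->
  \forall rho \near 0^'+, forall x x' u, `|x - z0.1| < rho ->
    `|x' - z0.1| < rho -> `|u - z0.2| < rho ->
    `|g (x, u) - g (x', u)
      - jac (fun y => g (y, z0.2)) z0.1 *m (x - x')| <= eta * `|x - x'|.
Proof.
move=> Cg eta0.
have dgx : differentiable (fun x => g (x, z0.2)) z0.1.
  by apply: differentiable_slice; case: Cg.
pose close (i : 'I_k) (rho : R) := forall x x' u,
    `|x - z0.1| < rho -> `|x' - z0.1| < rho -> `|u - z0.2| < rho ->
    `|g (x, u) i 0 - g (x', u) i 0
      - dot (grad (fun y => g (y, z0.2) i 0) z0.1) (x - x')|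
    <= eta * `|x - x'|.
have : \forall rho \near 0^'+, forall i, close i rho.
  apply: filter_forall => i.
  exact: (@strict_grad_fst (fun z => g z i 0) z0 eta (Ck_coord i 0 Cg)).
apply: filterS => rho Hrho x x' u xr x'r ur.
apply: norm_le_coord => [|i j]; first by rewrite mulr_ge0 // ltW.
have jacE : jac (fun y => g (y, z0.2)) z0.1 *m (x - x') =
    \col_l dot (grad (fun y => g (y, z0.2) l 0) z0.1) (x - x').
  apply/colP => l; rewrite !mxE dotE; apply: eq_bigr => j' _; congr (_ * _).
  by rewrite !mxE derive_mx ?mxE //; exact: diff_derivable.
rewrite jacE ord1; have := Hrho i x x' u xr x'r ur.
by rewrite !mxE.
Qed.

End StrictDifferentiability.

(** * Exponential stability forces a Hurwitz linearization *)

Section ExponentialStability.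
Context {R : realType} {n m : nat}.
Notation Z := ('cV[R]_n * 'cV[R]_m)%type.

Lemma near_right_witness (P : R -> Prop) :
  (\forall rho \near 0^'+, P rho) -> exists2 rho : R, 0 < rho & P rho.
Proof.
move=> HP.
have : \forall rho \near 0^'+, (0 : R) < rho /\ P rho.
  near=> rho; split; first by near: rho; exact: nbhs_right_gt.
  by near: rho.
by case/filter_ex => rho [rho0 Prho]; exists rho.
Unshelve. all: by end_near. Qed.

Lemma expR_le_inv (x : R) : 0 <= x -> expR (- x) <= (1 + x)^-1.
Proof.
move=> x0; rewrite expRN lef_pV2 ?posrE ?expR_gt0 ?ltr_wpDr //.
exact: expR_ge1Dx.
Qed.

(** If a left eigenvector l1 + i l2 had an eigenvalue with real part a >= 0,
    then Q = (l1 e)^2 + (l2 e)^2 could not decrease along e' = A e. Over a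
    fixed time T the nonlinear remainder lowers Q by at most a quarter of its
    initial value once the initial deviation del is small, while exponential
    decay at rate lam, over a T chosen in advance, brings Q down to a quarter
    of it. *)
Lemma exp_stable_hurwitz (f : 'cV[R]_n -> 'cV[R]_m -> 'cV[R]_n) u0 x0 :
  Ck 1 (fun z : Z => f z.1 z.2) -> f x0 u0 = 0 ->
  globally_exp_stable f u0 x0 ->
  let A := jac (fun x => f x u0) x0 in
  forall (a b : R) (l1 l2 : 'rV[R]_n), (l1 != 0) || (l2 != 0) ->
     l1 *m A = a *: l1 - b *: l2 -> l2 *m A = b *: l1 + a *: l2 -> a < 0.
Proof.
move=> Cf fx0 [exsol [k [lam [k0 lam0 decay]]]] A a b l1 l2 l0 l1A l2A.
rewrite ltNge; apply/negP => a0.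
pose L1 := l1^T; pose L2 := l2^T.
have L1A e : dot L1 (A *m e) = a * dot L1 e - b * dot L2 e.
  by rewrite /dot !trmxK mulmxA l1A mulmxBl -!scalemxAl !mxE.
have L2A e : dot L2 (A *m e) = b * dot L1 e + a * dot L2 e.
  by rewrite /dot !trmxK mulmxA l2A mulmxDl -!scalemxAl !mxE.
pose Q e := dot L1 e ^+ 2 + dot L2 e ^+ 2.
have [v Qv0] : exists v, 0 < Q v.
  case/orP: l0 => l0; [exists L1|exists L2]; rewrite /Q.
    by rewrite ltr_wpDr ?sqr_ge0 // exprn_gt0 // dotxx_gt0 // trmx_eq0.
  by rewrite ltr_wpDl ?sqr_ge0 // exprn_gt0 // dotxx_gt0 // trmx_eq0.
pose K : R := n%:R * (`|L1| + `|L2|).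
have K0 : 0 <= K by rewrite mulr_ge0 // addr_ge0.
have dotK1 e : `|dot L1 e| <= K * `|e|.
  rewrite (le_trans (dot_le_norm _ _)) // /K -mulrA ler_wpM2l //.
  by rewrite ler_wpM2r // lerDl.
have dotK2 e : `|dot L2 e| <= K * `|e|.
  rewrite (le_trans (dot_le_norm _ _)) // /K -mulrA ler_wpM2l //.
  by rewrite ler_wpM2r // lerDr.
clearbody K.
have sqr_le (x y : R) : `|x| <= y -> x ^+ 2 <= y ^+ 2.
  by move=> xy; rewrite -real_normK ?num_real // lerXn2r ?nnegrE ?(le_trans _ xy).
have QK e : Q e <= 2 * (K * `|e|) ^+ 2.
  by have := sqr_le _ _ (dotK1 e); have := sqr_le _ _ (dotK2 e); rewrite /Q; lra.
have [B B0 BE] : exists2 B : R, 0 <= B & B = K ^+ 2 * k ^+ 2 * `|v| ^+ 2.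
  exists (K ^+ 2 * k ^+ 2 * `|v| ^+ 2) => //.
  by apply: mulr_ge0; [apply: mulr_ge0|]; exact: sqr_ge0.
(* 1 + lam T >= 8 B / Q v, so 2 B exp(- lam T) <= Q v / 4. *)
have [T T0 TE] : exists2 T : R, 0 <= T & T = 8 * B / (Q v * lam).
  exists (8 * B / (Q v * lam)) => //.
  by rewrite divr_ge0 // ?mulr_ge0 // ltW // mulr_gt0.
(* Relative to del^2, the remainder costs at most 4 eta B T <= Q v / 4 over
   [0, T]. *)
pose eta : R := Q v / (4 * (4 * B * T + 1)).
have den0 : 0 < 4 * B * T + 1 by rewrite ltr_wpDl // !mulr_ge0.
have eta0 : 0 < eta by rewrite divr_gt0 // mulr_gt0.
have etaE : eta = Q v / (4 * (4 * B * T + 1)) by [].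
clearbody eta.
have [rho rho0 Hrho] := near_right_witness (strict_jac_fst (x0, u0) Cf eta0).
(* The whole trajectory stays in the ball of radius rho on which eta is
   valid. *)
pose del : R := rho / (2 * (k * `|v| + 1)).
have kv0 : 0 <= k * `|v| by rewrite mulr_ge0 // ltW.
have del0 : 0 < del by rewrite divr_gt0 // mulr_gt0 // ltr_wpDl.
have kdel : k * (del * `|v|) < rho.
  rewrite (_ : k * _ = k * `|v| * rho / (2 * (k * `|v| + 1))); last first.
    by rewrite /del; ring.
  rewrite ltr_pdivrMr ?mulr_gt0 ?ltr_wpDl //; nra.
clearbody del.
have [xi [xisol xi0]] := exsol (x0 + del *: v).
pose e (t : R) := xi t - x0.
have e0E : e 0 = del *: v by rewrite /e xi0 addrC addKr.
have edecay (t : R) : 0 <= t -> `|e t| <= k * expR (- lam * t) * (del * `|v|).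
  move=> t0; have := decay _ _ xisol t t0 (ltry _).
  by rewrite -/(e t) -/(e 0) e0E normrZ (gtr0_norm del0).
have ebound (t : R) : 0 <= t -> `|e t| <= k * (del * `|v|).
  move=> t0; apply: le_trans (edecay t t0) _.
  rewrite ler_wpM2r ?mulr_ge0 ?(ltW del0) // ger_pMr //.
  by rewrite -expR0 ler_expR mulNr oppr_le0 mulr_ge0 // ltW.
have de (t : R) : 0 <= t -> is_derive t (1 : R) e (f (xi t) u0).
  move=> t0; have dxi := xisol t t0 (ltry _).
  have := @is_deriveB _ _ _ xi (cst x0) t 1 _ _ dxi (is_derive_cst x0 t 1).
  by rewrite subr0.
pose Q' (t : R) : R := 2 * (dot L1 (e t) * dot L1 (f (xi t) u0))
           + 2 * (dot L2 (e t) * dot L2 (f (xi t) u0)).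
have dQ (t : R) : 0 <= t -> is_derive t (1 : R) (fun s => Q (e s)) (Q' t).
  move=> t0; have det := de t t0.
  have d1 := is_derive_sqr (is_derive_dotr L1 det).
  have d2 := is_derive_sqr (is_derive_dotr L2 det).
  exact: is_deriveD.
have Q'ge (t : R) : 0 <= t -> - (4 * eta * (B * del ^+ 2)) <= Q' t.
  move=> t0; pose rem := f (xi t) u0 - A *m e t.
  have remle : `|rem| <= eta * `|e t|.
    have := Hrho (xi t) x0 u0; rewrite /= !subrr !normr0 -/(e t).
    rewrite fx0 subr0; apply=> //.
    by rewrite (le_lt_trans (ebound t t0)).
  have fE : f (xi t) u0 = A *m e t + rem by rewrite /rem addrC subrK.
  have -> : Q' t = 2 * a * Q (e t)
      + 2 * (dot L1 (e t) * dot L1 rem + dot L2 (e t) * dot L2 rem).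
    rewrite /Q' /Q fE !(dotDr _ (A *m e t) rem) L1A L2A; ring.
  have prod (l : 'cV[R]_n) : (forall y, `|dot l y| <= K * `|y|) ->
      - (eta * (B * del ^+ 2)) <= dot l (e t) * dot l rem.
    move=> dotK; rewrite lerNl.
    apply: le_trans (_ : `|dot l (e t) * dot l rem| <= _).
      by rewrite -normrN ler_norm.
    rewrite normrM; apply: le_trans (_ : K * `|e t| * (K * (eta * `|e t|)) <= _).
      apply: ler_pM => //; apply: le_trans (dotK rem) _.
      by rewrite ler_wpM2l.
    rewrite (_ : K * _ * _ = eta * (K ^+ 2 * `|e t| ^+ 2)); last by ring.
    rewrite ler_wpM2l ?(ltW eta0) //.
    rewrite (_ : B * _ = K ^+ 2 * (k * (del * `|v|)) ^+ 2); last first.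
      by rewrite BE; ring.
    rewrite ler_wpM2l ?sqr_ge0 // lerXn2r ?nnegrE //.
      by rewrite !mulr_ge0 // ltW.
    exact: ebound.
  have := prod _ dotK1; have := prod _ dotK2.
  have : 0 <= 2 * a * Q (e t) by rewrite !mulr_ge0 // addr_ge0 // sqr_ge0.
  lra.
have QT : - (4 * eta * (B * del ^+ 2)) * T <= Q (e T) - Q (e 0).
  have := @derive_ge_increment R (fun s => Q (e s)) Q' 0 T _ T0
    (fun t tT => dQ t (andP tT).1) (fun t tT => Q'ge t (andP tT).1).
  by rewrite subr0.
have Q0E : Q (e 0) = del ^+ 2 * Q v by rewrite e0E /Q !dotZr; ring.
have QTle : Q (e T) <= del ^+ 2 * (Q v / 4).
  apply: le_trans (QK _) _.
  have x1 : expR (- lam * T) <= 1.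
    by rewrite -expR0 ler_expR mulNr oppr_le0 mulr_ge0 // ltW.
  have x2 : expR (- lam * T) <= (1 + lam * T)^-1.
    by rewrite mulNr expR_le_inv // mulr_ge0 // ltW.
  apply: le_trans (_ : 2 * B * del ^+ 2 * expR (- lam * T) <= _).
    rewrite (_ : 2 * B * del ^+ 2 * _ =
      2 * (K ^+ 2 * ((k * (del * `|v|)) ^+ 2 * expR (- lam * T)))); last first.
      by rewrite BE; ring.
    rewrite ler_wpM2l // exprMn ler_wpM2l ?sqr_ge0 //.
    apply: le_trans (_ : (k * expR (- lam * T) * (del * `|v|)) ^+ 2 <= _).
      rewrite lerXn2r ?nnegrE ?edecay // !mulr_ge0 ?expR_ge0 // ltW //.
    rewrite (_ : (k * expR (- lam * T) * _) ^+ 2 =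
      (k * (del * `|v|)) ^+ 2 * expR (- lam * T) ^+ 2); last by ring.
    by rewrite ler_wpM2l ?sqr_ge0 // expr2 ger_pMr ?expR_gt0.
  have lT : 2 * B <= Q v / 4 * (1 + lam * T).
    have -> : lam * T = 8 * B / Q v by rewrite TE; field; rewrite !gt_eqF.
    rewrite (_ : Q v / 4 * _ = Q v / 4 + 2 * B); last by field; rewrite gt_eqF.
    by rewrite lerDr divr_ge0 // ltW.
  have lT0 : 0 < 1 + lam * T by rewrite ltr_wpDr // mulr_ge0 // ltW.
  rewrite (_ : 2 * B * _ * _ = del ^+ 2 * (2 * B * expR (- lam * T))); last by ring.
  rewrite ler_wpM2l ?sqr_ge0 //.
  apply: le_trans (_ : 2 * B * (1 + lam * T)^-1 <= _).
    by rewrite ler_wpM2l // mulr_ge0.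
  by rewrite ler_pdivrMr.
have etaT : 4 * eta * B * T <= Q v / 4.
  rewrite (_ : 4 * eta * B * T = 4 * B * T * Q v / (4 * (4 * B * T + 1))).
    by rewrite ler_pdivrMr ?mulr_gt0 //; nra.
  by rewrite etaE; field; rewrite gt_eqF.
have del2 : 0 < del ^+ 2 by rewrite exprn_gt0.
have : del ^+ 2 * (4 * eta * B * T) <= del ^+ 2 * (Q v / 4).
  by rewrite ler_pM2l.
have : 0 < del ^+ 2 * Q v by rewrite mulr_gt0.
rewrite Q0E in QT; lra.
Qed.

End ExponentialStability.

(** * One inequality constraint: multipliers and projections *)

Section Optimality.
Context {R : realType}.

Lemma decrease_right (psi : R -> R) c :
  is_derive (0 : R) (1 : R) psi c -> c < 0 ->
  \forall s \near 0^'+, psi s < psi 0.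
Proof.
move=> [dpsi <-] c0.
have quot : (fun h : R => h^-1 *: (psi (h *: (1 : R) + 0) - psi 0)) @ 0^' -->
    'D_1 psi (0 : R) by exact: dpsi.
have : \forall h \near 0^', h^-1 *: (psi (h *: (1 : R) + 0) - psi 0) < 0.
  exact: (cvgr_lt _ quot).
move=> Hq; have : \forall h \near 0^'+,
    h^-1 *: (psi (h *: (1 : R) + 0) - psi 0) < 0.
  move: Hq => [e /= e0 He]; exists e => //= h hb h0.
  by apply: He => //=; rewrite gt_eqF.
move=> Hr; near=> s.
have s0 : 0 < s by near: s; exact: nbhs_right_gt.
have : s^-1 *: (psi (s *: (1 : R) + 0) - psi 0) < 0 by near: s.
rewrite addr0 /GRing.scale /= mulr1 pmulr_rlt0 ?invr_gt0 //.
by rewrite subr_lt0.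
Unshelve. all: by end_near. Qed.

Section KKT.
Context {d : nat} (phi b : 'cV[R]_d -> R) (u : 'cV[R]_d).
Hypothesis dphi : differentiable phi u.
Hypothesis db : differentiable b u.
Hypothesis umin : \forall u' \near u, 0 <= b u' -> phi u <= phi u'.

(** Along a direction that decreases phi and does not leave the feasible set,
    phi would take smaller values arbitrarily close to u. *)
Lemma no_feasible_descent v : dot (grad phi u) v < 0 ->
  0 < b u \/ b u = 0 /\ 0 < dot (grad b u) v -> False.
Proof.
move=> gv0 bv.
pose y (s : R) := u + s *: v.
have y0 : y 0 = u by rewrite /y scale0r addr0.
have dy := is_derive_line u v 0.
have ycont : {for 0, continuous y} by exact: is_derive_continuous dy.
have desc : \forall s \near 0^'+, phi (y s) < phi (y 0).
  apply: (@decrease_right (phi \o y) _ _ gv0).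
  by rewrite -[in grad _ _]y0; apply: is_derive_grad => //; rewrite y0.
have feas : \forall s \near 0^'+, 0 <= b (y s).
  case: bv => [b0|[b0 gb0]].
    have : \forall s \near 0, 0 < b (y s).
      have bcont : {for 0, continuous (b \o y)}.
        apply: continuous_comp => //.
        by rewrite y0; exact: differentiable_continuous.
      have bpos : 0 < (b \o y) 0 by rewrite /= y0.
      exact: (cvgr_gt _ bcont _ bpos).
    by move=> H; apply: cvg_within; apply: filterS H => s; exact: ltW.
  have : \forall s \near 0^'+, - b (y s) < - b (y 0).
    apply: (@decrease_right (fun s => - b (y s)) (- dot (grad b u) v)).
      apply: is_deriveN; rewrite -[in grad _ _]y0.
      by apply: is_derive_grad => //; rewrite y0.
    by rewrite oppr_lt0.
  by apply: filterS => s; rewrite y0 b0 ltrN2 => /ltW.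
have near_min : \forall s \near 0^'+, 0 <= b (y s) -> phi u <= phi (y s).
  have umin' : \forall u' \near y 0, 0 <= b u' -> phi u <= phi u' by rewrite y0.
  by apply: cvg_within; exact: (ycont _ umin').
near ((0 : R)^'+) => s.
have desc_s : phi (y s) < phi (y 0) by near: s.
have feas_s : 0 <= b (y s) by near: s.
have : 0 <= b (y s) -> phi u <= phi (y s) by near: s.
by move/(_ feas_s); rewrite y0 in desc_s; rewrite leNgt desc_s.
Unshelve. all: by end_near. Qed.

(** On an active constraint, let r be the residual of grad phi after
    projection on the ray spanned by grad b. If r is nonzero, the direction
    -r, tilted slightly by eta grad b into the interior, is a feasible descent
    direction. *)
Lemma local_min_KKT : 0 <= b u -> (b u = 0 -> grad b u <> 0) ->
  exists mu, [/\ 0 <= mu, mu * b u = 0 & grad phi u = mu *: grad b u].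
Proof.
set g := grad phi u; set a := grad b u => b0 a0.
move: b0; rewrite le_eqVlt => /orP[/eqP b0|b0]; last first.
  exists 0; rewrite mul0r scale0r; split => //.
  apply/eqP; apply: contrapT => /negP g0.
  apply: (@no_feasible_descent (- g)); last by left.
  by rewrite dotNr oppr_lt0 dotxx_gt0.
have {}a0 : a != 0 by apply/eqP/a0.
have A0 : 0 < dot a a by exact: dotxx_gt0.
pose tau := dot a g / dot a a; pose mu := Num.max 0 tau.
exists mu; rewrite -b0 mulr0; split => //; first by rewrite le_max lexx.
apply/eqP; rewrite -subr_eq0; apply: contrapT => /negP r0.
set r := g - mu *: a in r0.
have rr0 : 0 < dot r r by exact: dotxx_gt0.
have agE : dot a g = tau * dot a a by rewrite /tau divfK // gt_eqF.
have arE : dot a r = (tau - mu) * dot a a.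
  by rewrite /r dotDr dotNr dotZr agE; ring.
have mu_tau : mu * (tau - mu) = 0 /\ tau - mu <= 0.
  rewrite /mu; have [t0|t0] := leP 0 tau.
    by rewrite subrr mulr0.
  by rewrite mul0r subr0; split => //; exact: ltW.
have grE : dot g r = dot r r.
  have -> : g = r + mu *: a by rewrite /r subrK.
  by rewrite dotDl dotZl arE mulrA mu_tau.1 mul0r addr0.
(* Small enough for the tilt eta a to lose at most half of the descent dot r
   r. *)
pose eta := dot r r / (2 * (`|dot g a| + 1)).
have eta0 : 0 < eta by rewrite divr_gt0 // mulr_gt0 // ltr_wpDl.
apply: (@no_feasible_descent (eta *: a - r)); last first.
  right; split => //; rewrite dotDr dotNr dotZr arE.
  have := mu_tau.2; have : 0 < eta * dot a a by rewrite mulr_gt0.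
  nra.
rewrite dotDr dotNr dotZr grE subr_lt0.
apply: le_lt_trans (_ : eta * `|dot g a| < _).
  by rewrite ler_wpM2l ?ler_norm // ltW.
have /eqP : eta * (2 * (`|dot g a| + 1)) = dot r r.
  by rewrite /eta divfK // gt_eqF // mulr_gt0 // ltr_wpDl.
have := normr_ge0 (dot g a).
by move=> n0 /eqP <-; nra.
Qed.

End KKT.

(** Variational inequality of the projection of -p on the half-space dot a q +
    s >= 0: lam is the multiplier, and the excess of any competitor is at
    least its squared distance to q. *)
Lemma halfspace_projection d (p a q q' : 'cV[R]_d) (s lam : R) :
  0 <= lam -> q = lam *: a - p -> lam * (dot a q + s) = 0 ->
  0 <= dot a q' + s ->
  dot (q + p) (q + p) + dot (q' - q) (q' - q) <= dot (q' + p) (q' + p).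
Proof.
move=> lam0 qE compl feas.
have qp : q + p = lam *: a by rewrite qE subrK.
have -> : q' + p = (q' - q) + lam *: a by rewrite -qp addrA subrK.
rewrite qp; set w := q' - q.
have : 0 <= lam * dot a w.
  rewrite /w dotDr dotNr.
  have -> : lam * (dot a q' - dot a q) =
     lam * (dot a q' + s) - lam * (dot a q + s) by ring.
  by rewrite compl subr0 mulr_ge0.
clearbody w; rewrite !(dotDl, dotDr, dotZl, dotZr) (dotC w a).
have : 0 <= lam * (lam * dot a a) by rewrite !mulr_ge0 // dotxx_ge0.
lra.
Qed.

Lemma sum_continuous (T : topologicalType) d (g : 'I_d -> T -> R) (z : T) :
  (forall i, {for z, continuous (g i)}) ->
  {for z, continuous (fun z => \sum_i g i z)}.
Proof.
elim: d g => [|d IHd] g cg.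
  have -> : (fun z => \sum_(i < 0) g i z) = fun=> 0.
    by apply/funext => y; rewrite big_ord0.
  exact: cvg_cst.
have -> : (fun z => \sum_(i < d.+1) g i z) =
    fun z => g ord0 z + \sum_(i < d) g (lift ord0 i) z.
  by apply/funext => y; rewrite big_ord_recl.
apply: (@continuousD _ R^o _ (g ord0)) => //.
exact: (IHd (fun i => g (lift ord0 i))).
Qed.

Lemma dot_continuous (T : topologicalType) d (a c : T -> 'cV[R]_d) (z : T) :
  {for z, continuous a} -> {for z, continuous c} ->
  {for z, continuous (fun z => dot (a z) (c z))}.
Proof.
move=> ca cc.
have -> : (fun z => dot (a z) (c z)) =
    fun z => \sum_(i < d) a z i 0 * c z i 0.
  by apply/funext => y; rewrite dotE.
apply: sum_continuous => i; apply: cvgM.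
  exact: (continuous_comp ca (@coord_continuous _ _ _ i 0 (a z))).
exact: (continuous_comp cc (@coord_continuous _ _ _ i 0 (c z))).
Qed.

(** The multiplier of the projection on a half-space, as a function of a
    parameter. It vanishes near a point where the constraint is slack; where
    the constraint is active it is max(0, (a.p - s)/|a|^2), and a does not
    vanish nearby. In both cases it is continuous, and at a KKT point the
    projection is 0. *)
Lemma halfspace_multiplier (T : topologicalType) d (p a : T -> 'cV[R]_d)
    (s : T -> R) (z0 : T) :
  continuous p -> continuous a -> continuous s ->
  0 <= s z0 -> (s z0 = 0 -> a z0 <> 0) ->
  (exists mu, [/\ 0 <= mu, mu * s z0 = 0 & p z0 = mu *: a z0]) ->
  exists lam : T -> R, lam z0 *: a z0 - p z0 = 0 /\
    \forall z \near z0,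
      [/\ 0 <= lam z, lam z * (dot (a z) (lam z *: a z - p z) + s z) = 0,
          0 <= dot (a z) (lam z *: a z - p z) + s z &
          {for z, continuous lam}].
Proof.
move=> cp ca cs s0 a0 [mu [mu0 mus pE]].
have cap z : {for z, continuous (fun z => dot (a z) (p z))}.
  exact: (dot_continuous (ca z) (cp z)).
have caa z : {for z, continuous (fun z => dot (a z) (a z))}.
  exact: (dot_continuous (ca z) (ca z)).
move: s0; rewrite le_eqVlt => /orP[/eqP s0|s0]; last first.
  have mu00 : mu = 0.
    by apply/eqP; move/eqP: mus; rewrite mulf_eq0 (gt_eqF s0) orbF.
  exists (fun=> 0); split; first by rewrite pE mu00 !scale0r subrr.
  have : \forall z \near z0, 0 < s z - dot (a z) (p z).
    have : 0 < s z0 - dot (a z0) (p z0).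
      by rewrite pE mu00 scale0r dot0r subr0.
    by apply: cvgr_gt; apply: cvgB; [exact: cs|exact: cap].
  apply: filterS => z pos; rewrite scale0r sub0r dotNr addrC mul0r; split=> //.
    exact: ltW.
  exact: cvg_cst.
have A0 : 0 < dot (a z0) (a z0) by apply/dotxx_gt0/eqP/a0.
exists (fun z => Num.max 0 ((dot (a z) (p z) - s z) / dot (a z) (a z))).
split.
  rewrite pE -s0 subr0 dotZr mulfK ?gt_eqF // max_r //.
  by rewrite subrr.
have : \forall z \near z0, 0 < dot (a z) (a z) by exact: (cvgr_gt _ (caa z0) _ A0).
apply: filterS => z Az0; set tau := (_ - _) / _; set lam := Num.max 0 tau.
have apE : dot (a z) (p z) = tau * dot (a z) (a z) + s z.
  by rewrite /tau divfK ?gt_eqF // subrK.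
have E : dot (a z) (lam *: a z - p z) + s z = (lam - tau) * dot (a z) (a z).
  by rewrite dotDr dotNr dotZr apE; ring.
rewrite E; split.
- by rewrite le_max lexx.
- rewrite /lam; have [t0|t0] := leP 0 tau; first by rewrite subrr mul0r mulr0.
  by rewrite mul0r.
- by rewrite mulr_ge0 ?(ltW Az0) // subr_ge0 le_max lexx orbT.
- apply: continuous_max; first exact: cvg_cst.
  apply: cvgM; first by apply: cvgB; [exact: cap|exact: cs].
  by apply: cvgV; [rewrite gt_eqF|exact: caa].
Qed.

End Optimality.

(** * Compact balls *)

Section Compactness.
Context {R : realType}.

Lemma norm_trmx p q (M : 'M[R]_(p, q)) : `|M^T| = `|M|.
Proof.
apply/eqP; rewrite eq_le; apply/andP; split; apply: norm_le_coord => // i j.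
  by rewrite mxE coord_le_norm.
by have := coord_le_norm M^T j i; rewrite mxE.
Qed.

(** Transposition transports the compactness of bounded closed sets from rows
    to columns. *)
Lemma trmx_continuous p q : continuous (fun y : 'M[R]_(p, q) => y^T).
Proof.
move=> M A [P nP PA]; exists (fun i j => P j i) => [i j|N PN].
  by have := nP j i; rewrite mxE.
by apply: PA => i j; rewrite mxE; exact: PN.
Qed.

Lemma norm_sub_continuous (V : normedModType R) (z0 : V) :
  continuous (fun z => `|z - z0|).
Proof.
move=> z; apply: cvg_norm; apply: cvgB; [exact: cvg_id|exact: cvg_cst].
Qed.

Lemma closed_cball (V : normedModType R) (z0 : V) rho :
  closed [set z | `|z - z0| <= rho].
Proof.
apply: (@closed_comp _ _ (fun z => `|z - z0|) [set x | x <= rho]).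
  by move=> z _; exact: norm_sub_continuous.
exact: closed_le.
Qed.

Lemma compact_cball_cV d (x0 : 'cV[R]_d) rho :
  compact [set x | `|x - x0| <= rho].
Proof.
have -> : [set x | `|x - x0| <= rho] = trmx @` [set y | `|y - x0^T| <= rho].
  apply/seteqP; split => [x /= xr|_ [y /= yr <-]].
    by exists x^T; rewrite /= ?trmxK // -linearB /= norm_trmx.
  by rewrite -[x0]trmxK -linearB /= norm_trmx.
apply: continuous_compact.
  by apply: continuous_subspaceT => y; exact: trmx_continuous.
apply: bounded_closed_compact; last exact: closed_cball.
exists (`|x0^T| + rho); split; first exact: num_real.
move=> M Mr y /= yr; apply: le_trans (ltW Mr).
by rewrite -[y](subrK x0^T) addrC (le_trans (ler_normD _ _)) // lerD2l.
Qed.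

Lemma norm_pair_le (V1 V2 : normedModType R) (z : V1 * V2) (c : R) :
  (`|z| <= c) = (`|z.1| <= c) && (`|z.2| <= c).
Proof. by rewrite prod_normE ge_max. Qed.

Lemma compact_cball_pair n m (z0 : 'cV[R]_n * 'cV[R]_m) rho :
  compact [set z | `|z - z0| <= rho].
Proof.
have := compact_setX (@compact_cball_cV _ z0.1 rho) (@compact_cball_cV _ z0.2 rho).
congr compact; apply/seteqP; split => z /=.
  by move=> [z1 z2]; rewrite norm_pair_le z1 z2.
by rewrite norm_pair_le => /andP.
Qed.

Lemma compact_pos_lower_bound (T : topologicalType) (A : set T) (g : T -> R) :
  compact A -> (forall z, A z -> {for z, continuous g}) ->
  (forall z, A z -> 0 < g z) ->
  exists2 m : R, 0 < m & forall z, A z -> m <= g z.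
Proof.
move=> cA cg gpos; have [->|/set0P A0] := eqVneq A set0.
  by exists 1.
have gA : {within A, continuous g}.
  by apply: continuous_in_subspaceT => z /set_mem; exact: cg.
have [c cA' cmin] := compact_EVT_min A0 cA gA.
exists (g c) => [|z Az]; first by apply: gpos; exact: set_mem.
by apply: cmin; exact: mem_set.
Qed.

End Compactness.

(** * First exit time *)

Section FirstExit.
Context {R : realType}.

(** The exit time is the infimum of the times at which g is at least r. *)
Lemma first_exit (g : R -> R) (a b r : R) : a <= b ->
  (forall t, a <= t <= b -> {for t, continuous g}) ->
  g a < r -> r <= g b ->
  exists t, [/\ a <= t <= b, g t = r & forall s, a <= s <= t -> g s <= r].
Proof.
move=> ab cg gar rgb.
pose E : set R := [set t | a <= t <= b /\ r <= g t].
have Eb : E b by rewrite /E /= lexx ab.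
have Ea : lbound E a by move=> t [/andP[]].
have hE : has_inf E by split; [exists b|exists a].
pose t := inf E.
have at_ : a <= t by apply: lb_le_inf => //; exists b.
have tb : t <= b by apply: ge_inf => //; exists a.
have below s : a <= s -> s < t -> g s < r.
  move=> as_ st; rewrite ltNge; apply/negP => rs.
  have : E s by split => //; rewrite as_ (le_trans (ltW st)).
  by move=> /(ge_inf hE.2); rewrite leNgt st.
have cgt : {for t, continuous g} by apply: cg; rewrite at_.
have gt_r : r <= g t.
  rewrite leNgt; apply/negP => gtr.
  have : \forall s \near t, g s < r by exact: (cvgr_lt _ cgt _ gtr).
  case/nbhs_ballP => e /= e0 He.
  have [s [/andP[as_ sb] rs] ste] : exists2 s, E s & s < t + e.
    exact: inf_adherent.
  have ts : t <= s by apply: (ge_inf hE.2); split => //; rewrite as_.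
  have : g s < r.
    apply: He; rewrite -ball_normE /= distrC ger0_norm ?subr_ge0 //.
    by rewrite ltrBlDl.
  by rewrite ltNge rs.
have gt_le : g t <= r.
  rewrite leNgt; apply/negP => rgt.
  have a_lt_t : a < t.
    rewrite lt_neqAle at_ andbT; apply/eqP => aE.
    by move: rgt; rewrite -aE ltNge (ltW gar).
  have : \forall s \near t, r < g s by exact: (cvgr_gt _ cgt _ rgt).
  case/nbhs_ballP => e /= e0 He.
  (* A time before t, not before a, at which continuity still gives g > r. *)
  pose s := Num.max a (t - e / 2).
  have st : s < t by rewrite /s gt_max a_lt_t ltrBlDr ltrDl divr_gt0.
  have : r < g s.
    apply: He; rewrite -ball_normE /= gtr0_norm ?subr_gt0 //.
    rewrite ltrBlDl -ltrBlDr lt_max; apply/orP; right.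
    by rewrite ltrD2l ltrN2 ltr_pdivrMr // ltr_pMr // ltr1n.
  by rewrite ltNge ltW // below // le_max lexx.
exists t; split; first by rewrite at_.
  by apply/eqP; rewrite eq_le gt_le.
move=> s /andP[as_]; rewrite le_eqVlt => /orP[/eqP ->//|st].
by apply: ltW; exact: below.
Qed.

End FirstExit.

(** * Lyapunov theorems relative to a closed set *)

Section Lyapunov.
Context {R : realType} {Z : normedModType R}.

(** What a Lyapunov argument uses of a solution on [0, T) of an unspecified
    system: S cannot be left before the ball is left, and V decreases at rate
    at least D as long as the solution is in S and in the ball. *)
Definition dissipative (V D : Z -> R) (S : set Z) (zs : Z) (rho : R)
    (T : \bar R) (z : R -> Z) : Prop :=
  [/\ forall t : R, 0 <= t -> (t%:E < T)%E -> {for t, continuous z},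
      forall t : R, 0 <= t -> (t%:E < T)%E -> `|z t - zs| <= rho -> S (z t) ->
        exists2 v : R, is_derive t (1 : R) (V \o z) v & v <= - D (z t) &
      forall a t : R, 0 <= a -> a <= t -> (t%:E < T)%E ->
        (forall s, a <= s <= t -> `|z s - zs| <= rho) -> S (z a) -> S (z t)].

Variables (V D : Z -> R) (S : set Z) (zs : Z) (rho : R).
Hypothesis rho_gt0 : 0 < rho.
Hypothesis compact_ball : compact [set z | `|z - zs| <= rho].
Hypothesis closedS : closed S.
Hypothesis Vcont : forall z, `|z - zs| <= rho -> {for z, continuous V}.
Hypothesis Dcont : forall z, `|z - zs| <= rho -> {for z, continuous D}.
Hypothesis V0 : V zs = 0.
Hypothesis D0 : 0 <= D zs.
Hypothesis VDpos : forall z, `|z - zs| <= rho -> S z -> z != zs ->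
  0 < V z /\ 0 < D z.

Let D_ge0 z : `|z - zs| <= rho -> S z -> 0 <= D z.
Proof.
by have [->//|zzs zr Sz] := eqVneq z zs; apply: ltW; case: (VDpos zr Sz zzs).
Qed.

Let V_ge0 z : `|z - zs| <= rho -> S z -> 0 <= V z.
Proof.
have [->|zzs zr Sz] := eqVneq z zs; first by rewrite V0.
by apply: ltW; case: (VDpos zr Sz zzs).
Qed.

Lemma annulus_lower_bound (g : Z -> R) (r : R) : 0 < r ->
  (forall z, `|z - zs| <= rho -> {for z, continuous g}) ->
  (forall z, `|z - zs| <= rho -> S z -> z != zs -> 0 < g z) ->
  exists2 c : R, 0 < c &
    forall z, r <= `|z - zs| -> `|z - zs| <= rho -> S z -> c <= g z.
Proof.
move=> r0 cg gpos.
pose A := [set z | `|z - zs| <= rho] `&` ([set z | r <= `|z - zs|] `&` S).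
have cA : compact A.
  apply: compact_closedI => //; apply: closedI => //.
  apply: (@closed_comp _ _ (fun z => `|z - zs|) [set x | r <= x]).
    by move=> z _; exact: norm_sub_continuous.
  exact: closed_ge.
have [|z [zr [rz Sz]]|c c0 Hc] := @compact_pos_lower_bound R Z A g cA.
- by move=> z [zr _]; exact: cg.
- apply: gpos => //; rewrite -subr_eq0 -normr_gt0.
  exact: lt_le_trans rz.
by exists c => // z rz zr Sz; apply: Hc.
Qed.

(** On the part of the sphere of radius r that lies in S, V is at least some m
    > 0. A solution that starts where V < m cannot reach this sphere, since V
    does not increase before the first exit. The starting time a is arbitrary,
    so that the statement can be reapplied later along the same solution. *)
Lemma lyapunov_trap r : 0 < r -> r <= rho -> exists2 delta : R, 0 < delta &
  forall T z a, dissipative V D S zs rho T z -> 0 <= a -> S (z a) ->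
    `|z a - zs| < delta ->
    forall t : R, a <= t -> (t%:E < T)%E -> `|z t - zs| < r /\ S (z t).
Proof.
move=> r0 r_rho.
have [m m0 Hm] := annulus_lower_bound r0 Vcont
  (fun z zr Sz zz => (VDpos zr Sz zz).1).
have Vzs : {for zs, continuous V} by apply: Vcont; rewrite subrr normr0 ltW.
have : \forall z \near zs, V z < m.
  by apply: (cvgr_lt _ Vzs); rewrite V0.
case/nbhs_ballP => d /= d0 Hd.
exists (Num.min d r) => [|T z a [zcont zV zS] a0 Sa za t at_ tT].
  by rewrite lt_min d0.
have tT' s : s <= t -> (s%:E < T)%E.
  by move=> st; apply: le_lt_trans tT; rewrite lee_fin.
have Va : V (z a) < m.
  by apply: Hd; rewrite -ball_normE /= distrC; move: za; rewrite lt_min => /andP[].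
have inball s : a <= s -> s <= t -> `|z s - zs| < r.
  move=> as_ st; rewrite ltNge; apply/negP => rs.
  have cg t1 : a <= t1 <= s -> {for t1, continuous (fun t => `|z t - zs|)}.
    move=> /andP[at1 t1s].
    have zc := zcont t1 (le_trans a0 at1) (tT' _ (le_trans t1s st)).
    exact: (continuous_comp zc (@norm_sub_continuous R Z zs (z t1))).
  have ga : `|z a - zs| < r by move: za; rewrite lt_min => /andP[].
  have [t1 [/andP[at1 t1s] gt1 below]] := first_exit as_ cg ga rs.
  have t1t := le_trans t1s st.
  have inr u : a <= u <= t1 -> `|z u - zs| <= rho.
    by move=> /below/le_trans; apply.
  have Su u : a <= u <= t1 -> S (z u).
    move=> /andP[au ut1]; apply: (zS a u) => //.
      exact: tT' (le_trans ut1 t1t).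
    by move=> w /andP[aw wu]; apply: inr; rewrite aw (le_trans wu).
  have /choice[V' HV'] : forall u, exists v, a <= u <= t1 ->
      is_derive u (1 : R) (V \o z) v /\ v <= - D (z u).
    move=> u; have [au|au] := boolP (a <= u <= t1); last by exists 0.
    have /andP[au1 ut1] := au.
    have [v dv vD] := zV u (le_trans a0 au1) (tT' _ (le_trans ut1 t1t))
      (inr u au) (Su u au).
    by exists v.
  have : (V \o z) t1 - (V \o z) a <= 0 * (t1 - a).
    apply: (@derive_le_increment R (V \o z) V' a t1 0 at1).
      by move=> u /HV'[].
    move=> u au; have [_ /le_trans] := HV' u au; apply.
    by rewrite oppr_le0; apply: D_ge0; [exact: inr|exact: Su].
  have t1r : a <= t1 <= t1 by rewrite at1 lexx.
  have := Hm (z t1); rewrite gt1 lexx => /(_ isT r_rho (Su _ t1r)).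
  move: Va; rewrite mul0r /=; lra.
split; first by apply: inball.
apply: (zS a t) => // s /andP[as_ st]; apply: ltW.
by apply: lt_le_trans r_rho; exact: inball.
Qed.

(** While the solution stays at distance at least d from zs, V decreases at a
    rate bounded below by compactness; as V is nonnegative this cannot last,
    so the solution enters the trap of any prescribed radius. *)
Lemma lyapunov_attractive delta : 
  (forall T z a, dissipative V D S zs rho T z -> 0 <= a -> S (z a) ->
    `|z a - zs| < delta ->
    forall t : R, a <= t -> (t%:E < T)%E -> `|z t - zs| < rho /\ S (z t)) ->
  forall z, dissipative V D S zs rho +oo%E z -> S (z 0) ->
    `|z 0 - zs| < delta -> z t @[t --> +oo] --> zs.
Proof.
move=> trap z dz S0 z0; have [zcont zV zS] := dz.
have inr t : 0 <= t -> `|z t - zs| < rho /\ S (z t).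
  by move=> t0; apply: (trap _ _ 0 dz) => //; exact: ltry.
apply/cvgrPdist_lt => e e0.
pose r := Num.min e rho.
have r0 : 0 < r by rewrite lt_min e0.
have r_rho : r <= rho by rewrite ge_min lexx orbT.
have [d d0 trapr] := lyapunov_trap r0 r_rho.
have [c c0 Hc] := annulus_lower_bound d0 Dcont
  (fun z zr Sz zz => (VDpos zr Sz zz).2).
have [a a0 za] : exists2 a, 0 <= a & `|z a - zs| < d.
  apply: contrapT => nexa.
  have far t : 0 <= t -> d <= `|z t - zs|.
    by move=> t0; rewrite leNgt; apply/negP => zt; apply: nexa; exists t.
  (* By this time V would have dropped to -1. *)
  pose b := (V (z 0) + 1) / c.
  have b0 : 0 <= b.
    rewrite divr_ge0 ?(ltW c0) // addr_ge0 // V_ge0 //.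
    by apply: ltW; case: (inr 0 (lexx 0)).
  have /choice[V' HV'] : forall u, exists v, 0 <= u <= b ->
      is_derive u (1 : R) (V \o z) v /\ v <= - D (z u).
    move=> u; have [/andP[u0 ub]|au] := boolP (0 <= u <= b); last by exists 0.
    have [zu Su] := inr u u0.
    have [v dv vD] := zV u u0 (ltry _) (ltW zu) Su.
    by exists v.
  have : (V \o z) b - (V \o z) 0 <= - c * (b - 0).
    apply: (@derive_le_increment R (V \o z) V' 0 b (- c) b0).
      by move=> u /HV'[].
    move=> u ub; have [_ /le_trans] := HV' u ub; apply.
    have /andP[u0 _] := ub; have [zu Su] := inr u u0.
    by rewrite lerN2; apply: Hc => //; [exact: far|exact: ltW].
  have [zb Sb] := inr b b0.
  have := V_ge0 (ltW zb) Sb.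
  have : c * b = V (z 0) + 1 by rewrite /b mulrCA divff ?mulr1 // gt_eqF.
  rewrite /= subr0; lra.
exists a; split; first exact: num_real.
move=> t at_; rewrite distrC.
have [zt _] := trapr _ _ a dz a0 (inr a a0).2 za t (ltW at_) (ltry _).
by apply: lt_le_trans zt _; rewrite ge_min lexx.
Qed.

End Lyapunov.

(** * One-sided limits of curves *)

Section Curves.
Context {R : realType}.

Lemma is_derive_pairP (V1 V2 : normedModType R) (z : R -> V1 * V2) (t : R)
    (v : V1 * V2) :
  is_derive t (1 : R) z v <->
  is_derive t (1 : R) (fun s => (z s).1) v.1 /\
  is_derive t (1 : R) (fun s => (z s).2) v.2.
Proof.
split=> [dz|[[d1 v1] [d2 v2]]].
  split.
    have -> : v.1 = 'D_v (fst : V1 * V2 -> V1) (z t).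
      rewrite deriveE; last exact: differentiable_fst.
      by rewrite diff_lin // => y; exact: cvg_fst.
    by apply: is_derive_comp_curve => //; exact: differentiable_fst.
  have -> : v.2 = 'D_v (snd : V1 * V2 -> V2) (z t).
    rewrite deriveE; last exact: differentiable_snd.
    by rewrite diff_lin // => y; exact: cvg_snd.
  by apply: is_derive_comp_curve => //; exact: differentiable_snd.
move/derivable1_diffP : (d1) => D1; move/derivable1_diffP : (d2) => D2.
have zE : z = fun s => ((z s).1, (z s).2) by apply/funext => s; case: (z s).
have dz : differentiable z t by rewrite zE; exact: differentiable_pair.
split; first by apply/derivable1_diffP.
by rewrite deriveE // zE diff_pair // -!deriveE // v1 v2; case: (v).
Qed.

Lemma is_derive_translate (V : normedModType R) (g : R -> V) (t T : R) v :
  is_derive (t - T) (1 : R) g v -> is_derive t (1 : R) (fun s => g (s - T)) v.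
Proof.
have E : (fun h : R => h^-1 *: (((fun s => g (s - T)) \o shift t) (h *: (1 : R))
      - g (t - T))) =
    fun h : R => h^-1 *: ((g \o shift (t - T)) (h *: (1 : R)) - g (t - T)).
  by apply/funext => h /=; rewrite addrA.
move=> [dg vE]; split; first by rewrite /derivable E.
by rewrite -vE /derive E.
Qed.

Lemma is_derive_quotient (V : normedModType R) (g : R -> V) (t : R) v :
  (fun h : R => h^-1 *: (g (h *: (1 : R) + t) - g t)) @ 0^' --> v ->
  is_derive t (1 : R) g v.
Proof.
move=> gv; split; first exact: (cvgP v gv).
exact: cvg_lim gv.
Qed.

(** If the derivative has a limit c on the left of T, the mean value theorem
    makes c the left derivative; together with the derivative of the
    right-hand piece g2 this yields a two-sided derivative. *)
Lemma is_derive_junction (g g2 g' : R -> R) (a T c : R) : a < T ->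
  (forall s, a < s -> s < T -> is_derive s (1 : R) g (g' s)) ->
  g s @[s --> T^'-] --> g T -> g' s @[s --> T^'-] --> c ->
  is_derive T (1 : R) g2 c -> (forall s, T <= s -> g s = g2 s) ->
  is_derive T (1 : R) g c.
Proof.
move=> aT dg gT g'c [dg2 g2c] gE; apply: is_derive_quotient.
apply/cvgrPdist_le => e e0.
have g2q : (fun h : R => h^-1 *: (g2 (h *: (1 : R) + T) - g2 T)) @ 0^' --> c.
  by rewrite -g2c; exact: dg2.
have right : \forall h \near 0^',
    `|c - h^-1 *: (g2 (h *: (1 : R) + T) - g2 T)| <= e.
  by move/cvgrPdist_le : g2q; apply.
have : \forall s \near T^'-, `|c - g' s| <= e by move/cvgrPdist_le : g'c; apply.
case=> d /= d0 Hd.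
near=> h.
have hne : h != 0 by near: h; exact: nbhs_dnbhs_neq.
have hd : `|h| < d by near: h; exact: dnbhs0_lt.
have ha : `|h| < T - a by near: h; apply: dnbhs0_lt; rewrite subr_gt0.
have [h0|h0|h0] := ltgtP h 0; last by rewrite h0 eqxx in hne.
  rewrite ltr0_norm // in hd ha.
  have TE : h *: (1 : R) + T = T + h by rewrite /GRing.scale /= mulr1 addrC.
  have ThT : T + h < T by rewrite gtrDl.
  have [s] : exists2 s, s \in `](T + h), T[%R &
      g T - g (T + h) = g' s * (T - (T + h)).
    apply: MVT => // [s|]; first rewrite in_itv /= => /andP[s1 s2].
      by apply: dg => //; apply: lt_trans s1; lra.
    apply/continuous_within_itvP => //; split => // [s|].
      rewrite in_itv /= => /andP[s1 s2].
      have as_ : a < s by apply: lt_trans s1; lra.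
      exact: is_derive_continuous (dg s as_ s2).
    have aTh : a < T + h by lra.
    have ThC : {for T + h, continuous g}.
      exact: is_derive_continuous (dg _ aTh ThT).
    exact: cvg_at_right_filter.
  rewrite in_itv /= => /andP[s1 s2] gE'.
  have -> : h^-1 *: (g (h *: (1 : R) + T) - g T) = g' s.
    rewrite TE -opprB gE' /GRing.scale /=; field.
    by rewrite lt_eqF.
  apply: Hd => //=; rewrite gtr0_norm ?subr_gt0 //; lra.
have TE : T <= h *: (1 : R) + T by rewrite /GRing.scale /= mulr1 lerDr ltW.
rewrite (gE _ TE) (gE T (lexx T)); near: h; exact: right.
Unshelve. all: by end_near. Qed.

(** A Lipschitz curve is Cauchy at the end of its interval of definition. *)
Lemma lipschitz_cvg_at_left p q (g : R -> 'M[R]_(p, q)) (T M : R) : 0 < T ->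
  0 < M ->
  (forall s t, 0 <= s -> s <= t -> t < T -> `|g t - g s| <= M * (t - s)) ->
  exists l : 'M[R]_(p, q), g s @[s --> T^'-] --> l.
Proof.
move=> T0 M0 lip; suff gl : cvg (g @ T^'-) by exists (lim (g @ T^'-)).
apply/cauchy_cvgP; apply: cauchy_exP => e e0 /=.
pose s := Num.max 0 (T - e / (2 * M)).
have s0 : 0 <= s by rewrite le_max lexx.
have eM : 0 < e / (2 * M) by rewrite divr_gt0 // mulr_gt0.
have sT : s < T by rewrite gt_max T0 ltrBlDr ltrDl.
exists (g s); near=> t.
have st : s <= t by near: t; exact: nbhs_left_ge.
have tT : t < T by near: t; exact: nbhs_left_lt.
rewrite /= -ball_normE /= distrC; apply: le_lt_trans (lip s t s0 st tT) _.
apply: le_lt_trans (_ : M * (e / (2 * M)) < _).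
  rewrite ler_wpM2l ?(ltW M0) //.
  have : T - e / (2 * M) <= s by rewrite le_max lexx orbT.
  lra.
by rewrite (_ : M * _ = e / 2) ?ltr_pdivrMr ?ltr_pMr ?ltr1n //; field;
   rewrite gt_eqF.
Unshelve. all: by end_near. Qed.

End Curves.

(** * Global continuation of bounded solutions *)

Section Continuation.
Context {R : realType} {n m : nat}.
Notation Z := ('cV[R]_n * 'cV[R]_m)%type.
Variable Rhs : Z -> Z -> Prop.

Definition ode_solution (T : \bar R) (z : R -> Z) : Prop :=
  forall t : R, 0 <= t -> (t%:E < T)%E ->
    exists2 v, Rhs (z t) v & is_derive t (1 : R) z v.

Lemma ode_solution_le (T T' : \bar R) z : (T' <= T)%E ->
  ode_solution T z -> ode_solution T' z.
Proof. by move=> TT' sol t t0 tT; apply: sol => //; exact: lt_le_trans TT'. Qed.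

(** The glued curve takes at time t the value at t of a solution that lives
    beyond t; uniqueness makes it coincide with that solution near t. Negative
    times, where uniqueness says nothing, all use the solution chosen for t =
    0, so that the two-sided derivative at 0 is also correct. *)
Lemma glue_solutions (T : \bar R) (z0 : Z) : (0 < T)%E ->
  (forall (T1 T2 : \bar R) z1 z2, ode_solution T1 z1 -> ode_solution T2 z2 ->
    z1 0 = z0 -> z2 0 = z0 ->
    forall t : R, 0 <= t -> (t%:E < T1)%E -> (t%:E < T2)%E -> z1 t = z2 t) ->
  (forall t : R, 0 <= t -> (t%:E < T)%E -> exists T' : R, t < T' /\
    exists z, ode_solution T'%:E z /\ z 0 = z0) ->
  exists z, ode_solution T z /\ z 0 = z0.
Proof.
move=> T0 uniq ext.
have /choice[P HP] : forall t : R, exists p : R * (R -> Z),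
    0 <= t -> (t%:E < T)%E ->
    [/\ t < p.1, ode_solution p.1%:E p.2 & p.2 0 = z0].
  move=> t; have [[t0 tT]|no] := pselect (0 <= t /\ (t%:E < T)%E).
    by have [T' [tT' [z [solz zz0]]]] := ext t t0 tT; exists (T', z).
  by exists (0, fun=> z0) => t0 tT; exfalso; apply: no.
pose W (t : R) := if t < 0 then (P 0).2 t else (P t).2 t.
exists W; split; last first.
  by rewrite /W ltxx; have [] := HP 0 (lexx _) T0.
move=> t t0 tT; have [tP solP Pz0] := HP t t0 tT.
have Wt : W t = (P t).2 t by rewrite /W ltNge t0.
have [v Rv dv] := solP t t0 tP; exists v; first by rewrite Wt.
apply: near_eq_is_derive dv.
have nearT : \forall s \near t, (s%:E < T)%E.
  case: (T) tT => [r|//|//]; rewrite ?lte_fin => tr.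
    by near=> s; rewrite lte_fin; near: s; exact: lt_nbhsl.
  by near=> s; exact: ltry.
have nears : \forall s \near t, s < 0 -> t = 0.
  move: t0; rewrite le_eqVlt => /orP[/eqP <-|t0]; first by near=> s.
  have : \forall s \near t, 0 < s by exact: lt_nbhsr.
  by apply: filterS => s s0 /lt_trans/(_ s0); rewrite ltxx.
near=> s; rewrite /W; case: ltP => [s0|s0].
  have -> // : t = 0.
  by move: s0; near: s.
have sT : (s%:E < T)%E by near: s.
have [sP solPs Psz0] := HP s s0 sT.
apply: (uniq _ _ _ _ solP solPs) => //; rewrite lte_fin.
by near: s; exact: lt_nbhsl.
Unshelve. all: by end_near. Qed.

Variables (K : set Z) (F : Z -> Z) (M : R).
Hypothesis M_gt0 : 0 < M.
Hypothesis closedK : closed K.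
Hypothesis RhsF : forall z v, K z -> Rhs z v -> v = F z.
Hypothesis Fcont : forall z, K z -> {for z, continuous F}.
Hypothesis Fbound : forall z, K z -> `|F z| <= M.
Hypothesis local_ex : forall z0, K z0 ->
  exists (T : \bar R) z, [/\ (0 < T)%E, ode_solution T z & z 0 = z0].

Lemma bounded_solution_lipschitz (T : R) z : ode_solution T%:E z ->
  (forall t, 0 <= t -> t < T -> K (z t)) ->
  forall s t, 0 <= s -> s <= t -> t < T ->
    `|(z t).1 - (z s).1| <= M * (t - s) /\ `|(z t).2 - (z s).2| <= M * (t - s).
Proof.
move=> sol Kz s t s0 st tT.
have dz u : s <= u <= t -> is_derive u (1 : R) z (F (z u)).
  move=> /andP[su ut]; have u0 := le_trans s0 su.
  have uT := le_lt_trans ut tT.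
  have [v Rv dv] := sol u u0 uT.
  by rewrite -(RhsF (Kz u u0 uT) Rv).
have Fu u : s <= u <= t -> `|(F (z u)).1| <= M /\ `|(F (z u)).2| <= M.
  move=> /andP[su ut].
  have := Fbound (Kz u (le_trans s0 su) (le_lt_trans ut tT)).
  by rewrite norm_pair_le => /andP.
have lip (g g' : R -> R) :
    (forall u, s <= u <= t -> is_derive u (1 : R) g (g' u)) ->
    (forall u, s <= u <= t -> `|g' u| <= M) -> `|g t - g s| <= M * (t - s).
  move=> dg bg; rewrite ler_norml; apply/andP; split.
    rewrite -mulNr; apply: (@derive_ge_increment R g g') => // u /bg.
    by rewrite ler_norml => /andP[].
  apply: (@derive_le_increment R g g') => // u /bg.
  by rewrite ler_norml => /andP[].
have Mts : 0 <= M * (t - s) by rewrite mulr_ge0 ?subr_ge0 // ltW.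
split; apply: norm_le_coord => // i j; rewrite !mxE.
  apply: (lip (fun u => (z u).1 i j) (fun u => (F (z u)).1 i j)) => u us.
    by case/is_derive_pairP : (dz u us) => /is_derive_mxP.
  by apply: le_trans (coord_le_norm _ _ _) _; case: (Fu u us).
apply: (lip (fun u => (z u).2 i j) (fun u => (F (z u)).2 i j)) => u us.
  by case/is_derive_pairP : (dz u us) => _ /is_derive_mxP.
by apply: le_trans (coord_le_norm _ _ _) _; case: (Fu u us).
Qed.

Let coord1 i j : continuous (fun z : Z => z.1 i j).
Proof.
move=> z; apply: (@continuous_comp _ _ _ fst (fun M : 'cV[R]_n => M i j)).
  exact: cvg_fst.
exact: coord_continuous.
Qed.

Let coord2 i j : continuous (fun z : Z => z.2 i j).
Proof.
move=> z; apply: (@continuous_comp _ _ _ snd (fun M : 'cV[R]_m => M i j)).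
  exact: cvg_snd.
exact: coord_continuous.
Qed.

(** A solution with bounded velocity has a limit at time T; the solution that
    starts at this limit is attached there, and continuity of the velocity
    field makes the junction differentiable. *)
Lemma extend_solution (T : R) z : 0 < T -> ode_solution T%:E z ->
  (forall t, 0 <= t -> t < T -> K (z t)) ->
  exists (T' : R) z', [/\ T < T', ode_solution T'%:E z' & z' 0 = z 0].
Proof.
move=> T0 sol Kz.
have lip := bounded_solution_lipschitz sol Kz.
have [l1 z1] := lipschitz_cvg_at_left T0 M_gt0
  (fun s t s0 st tT => (lip s t s0 st tT).1).
have [l2 z2] := lipschitz_cvg_at_left T0 M_gt0
  (fun s t s0 st tT => (lip s t s0 st tT).2).
pose zc : Z := (l1, l2).
have zcvg : z s @[s --> T^'-] --> zc.
  have -> : z = fun s => ((z s).1, (z s).2) by apply/funext => s; case: (z s).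
  exact: (cvg_pair z1 z2).
have nearT : \forall s \near T^'-, 0 <= s /\ s < T.
  near=> s; split; near: s; [exact: nbhs_left_ge|exact: nbhs_left_lt].
have Kzc : K zc.
  have nearK : \forall s \near T^'-, K (z s).
    by apply: filterS nearT => s [s0 sT]; exact: Kz.
  exact: (closed_cvg K closedK nearK zc zcvg).
have [T2 [y [T20 soly y0]]] := local_ex Kzc.
have [t2 t20 t2T] : exists2 t2 : R, 0 < t2 & (t2%:E <= T2)%E.
  case: T2 T20 {soly} => [r|_|//]; first by rewrite lte_fin => r0; exists r.
  by exists 1 => //; exact: leey.
pose W (s : R) : Z := if s < T then z s else y (s - T).
have WT : W T = zc by rewrite /W ltxx subrr.
exists (T + t2), W; split; first by rewrite ltrDl.
  move=> t t0; rewrite lte_fin => tT2.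
  have [tT|Tt|tT] := ltgtP t T.
  - have [v Rv dv] := sol t t0 tT; exists v; first by rewrite /W tT.
    apply: near_eq_is_derive dv; near=> s; rewrite /W.
    by have -> : s < T by near: s; exact: lt_nbhsl.
  - have [v Rv dv] : exists2 v, Rhs (y (t - T)) v & is_derive (t - T) (1 : R) y v.
      apply: soly; first by rewrite subr_ge0 ltW.
      by apply: lt_le_trans t2T; rewrite lte_fin; lra.
    exists v; first by rewrite /W ltNge (ltW Tt).
    apply: near_eq_is_derive (is_derive_translate dv); near=> s; rewrite /W.
    have Ts : T < s by near: s; exact: lt_nbhsr.
    by rewrite ltNge (ltW Ts).
  - rewrite tT; have [v Rv dv] := soly 0 (lexx _) T20.
    rewrite y0 in Rv; have vE := RhsF Kzc Rv.
    exists v; first by rewrite WT.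
    have dyT : is_derive T (1 : R) (fun s => y (s - T)) v.
      by apply: is_derive_translate; rewrite subrr.
    have WgE s : T <= s -> W s = y (s - T) by rewrite /W leNgt => /negbTE ->.
    have FzT : F (z s) @[s --> T^'-] --> v.
      by rewrite vE; apply: (cvg_comp _ _ zcvg); exact: Fcont.
    have dW s : 0 < s -> s < T -> is_derive s (1 : R) W (F (z s)).
      move=> s0 sT; have [v' Rv' dv'] := sol s (ltW s0) sT.
      rewrite -(RhsF (Kz s (ltW s0) sT) Rv').
      apply: near_eq_is_derive dv'; near=> s'; rewrite /W.
      by have -> : s' < T by near: s'; exact: lt_nbhsl.
    have Wcvg : W s @[s --> T^'-] --> W T.
      rewrite WT; apply: cvg_trans zcvg; apply: near_eq_cvg.
      by apply: filterS nearT => s [_ sT]; rewrite /W sT.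
    apply/is_derive_pairP; split; apply/is_derive_mxP => i j.
      apply: (@is_derive_junction _ (fun s => (W s).1 i j)
        (fun s => (y (s - T)).1 i j)
        (fun s => (F (z s)).1 i j) 0 T) => //.
      + move=> s s0 sT.
        by case/is_derive_pairP: (dW s s0 sT) => /is_derive_mxP.
      + exact: (continuous_cvg _ (@coord1 i j (W T)) Wcvg).
      + exact: (continuous_cvg _ (@coord1 i j (v)) FzT).
      + by case/is_derive_pairP: dyT => /is_derive_mxP.
      + by move=> s Ts; rewrite WgE.
    apply: (@is_derive_junction _ (fun s => (W s).2 i j)
        (fun s => (y (s - T)).2 i j)
      (fun s => (F (z s)).2 i j) 0 T) => //.
    + move=> s s0 sT.
      by case/is_derive_pairP: (dW s s0 sT) => _ /is_derive_mxP.
    + exact: (continuous_cvg _ (@coord2 i j (W T)) Wcvg).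
    + exact: (continuous_cvg _ (@coord2 i j (v)) FzT).
    + by case/is_derive_pairP: dyT => _ /is_derive_mxP.
    + by move=> s Ts; rewrite WgE.
by rewrite /W T0.
Unshelve. all: by end_near. Qed.

(** Otherwise the existence times would have a finite supremum T; gluing gives
    a solution on [0, T), which can be extended beyond T. *)
Lemma global_solution (z0 : Z) : K z0 ->
  (forall (T1 T2 : \bar R) z1 z2, ode_solution T1 z1 -> ode_solution T2 z2 ->
    z1 0 = z0 -> z2 0 = z0 ->
    forall t : R, 0 <= t -> (t%:E < T1)%E -> (t%:E < T2)%E -> z1 t = z2 t) ->
  (forall (T : \bar R) z, ode_solution T z -> z 0 = z0 ->
    forall t : R, 0 <= t -> (t%:E < T)%E -> K (z t)) ->
  exists z, ode_solution +oo%E z /\ z 0 = z0.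
Proof.
move=> Kz0 uniq inK.
pose E : set R := [set T | 0 < T /\ exists z, ode_solution T%:E z /\ z 0 = z0].
have E0 : E !=set0.
  have [T [z [T0 sol zz0]]] := local_ex Kz0.
  case: T T0 sol => [r|_|//] => [r0|] sol.
    by exists r; split; [rewrite -lte_fin|exists z].
  by exists 1; split => //; exists z; split => //; apply: ode_solution_le sol; exact: leey.
have [bE|nbE] := pselect (has_ubound E); last first.
  apply: glue_solutions uniq _ => // t t0 _; apply: contrapT => noT.
  apply: nbE; exists t => T [T0 ET]; rewrite leNgt; apply/negP => tT.
  by apply: noT; exists T.
have supE : has_sup E by [].
pose T := sup E.
have T0 : 0 < T.
  have [T1 ET1] := E0; apply: lt_le_trans (_ : T1 <= _); first by case: ET1.
  exact: sup_ubound.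
have [z [solz zz0]] : exists z, ode_solution T%:E z /\ z 0 = z0.
  apply: glue_solutions uniq _; first by rewrite lte_fin.
  move=> t t0; rewrite lte_fin => tT.
  have [T' [T'0 ET'] tT'] : exists2 T', E T' & t < T' by exact: sup_gt.
  by exists T'.
have [T' [z' [TT' sol' z'0]]] := extend_solution T0 solz
  (fun t t0 tT => inK _ _ solz zz0 t t0 (tT : (t%:E < T%:E)%E)).
have : T' <= T.
  apply: sup_ubound => //; split; first exact: lt_trans TT'.
  by exists z'; split => //; rewrite z'0.
by rewrite leNgt TT'.
Qed.

End Continuation.

(** * Critical points of the steady-state problem *)

Section ProblemP.
Context {R : realType} {n m : nat}.
Notation Z := ('cV[R]_n * 'cV[R]_m)%type.
Variables (Phi h : 'cV[R]_n -> R) (b : 'cV[R]_m -> R) (w : 'cV[R]_m -> 'cV[R]_n).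
Hypothesis dPhi : forall x, differentiable Phi x.
Hypothesis dh : forall x, differentiable h x.
Hypothesis db : forall u, differentiable b u.
Hypothesis dw : forall u, differentiable w u.

Lemma P_eq_jacT (z : Z) (l : 'cV[R]_n) :
  (jac2 (P_eq w) z)^T *m l = col_mx l (- ((jac w z.2)^T *m l)).
Proof.
rewrite tr_row_mx mul_col_mx -mulNmx; congr col_mx.
  rewrite -[RHS]mul1mx; congr (_ *m _); apply/matrixP => i j; rewrite !mxE.
  rewrite (_ : (fun x => P_eq w (x, z.2)) = id - cst (w z.2)) //.
  rewrite deriveB ?derive_id ?derive_cst ?subr0 ?mxE ?eqxx ?andbT //.
  by rewrite eq_sym.
congr (_ *m _); apply/matrixP => i j; rewrite !mxE.
rewrite (_ : (fun u => P_eq w (z.1, u)) = cst z.1 - w) //.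
rewrite deriveB ?derive_cst ?sub0r ?mxE //.
exact: diff_derivable.
Qed.

Lemma P_ineq_jacT (z : Z) (mu : 'cV[R]_2) :
  (jac2 (P_ineq h b) z)^T *m mu =
  col_mx (mu 0 0 *: grad h z.1) (mu 1 0 *: grad b z.2).
Proof.
have derE (V : normedModType R) (g0 g1 : V -> R) y v i :
    derivable g0 y v -> derivable g1 y v ->
    ('D_v (fun x => \col_(i < 2) (if i == 0 then g0 x else g1 x)) y) i 0 =
    if i == 0 then 'D_v g0 y else 'D_v g1 y.
  move=> d0 d1.
  have coordE (i' : 'I_2) (j' : 'I_1) :
      (fun x => (\col_(i < 2) (if i == 0 then g0 x else g1 x)) i' j') =
      if i' == 0 then g0 else g1.
    by apply/funext => x; rewrite mxE; case: (i' == 0).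
  rewrite derive_mx; last first.
    apply/derivable_mxP => i' j'; rewrite coordE.
    by case: (i' == 0); [exact: d0|exact: d1].
  by rewrite mxE coordE; case: (i == 0).
rewrite tr_row_mx mul_col_mx; congr (col_mx _ _); apply/colP => j.
  rewrite !mxE big_ord_recl big_ord1 !mxE.
  rewrite !derE ?eqxx /=; try exact: diff_derivable; try exact: derivable_cst.
  by rewrite (derive_cst (b z.2)) mul0r addr0 mulrC.
rewrite !mxE big_ord_recl big_ord1 !mxE.
rewrite !derE ?eqxx /=; try exact: diff_derivable; try exact: derivable_cst.
rewrite (derive_cst (h z.1)) mul0r add0r mulrC.
by congr (mu _ _ * _); apply: val_inj.
Qed.

Lemma grad2_fst (z : Z) : grad2 (fun z' : Z => Phi z'.1) z = col_mx (grad Phi z.1) 0.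
Proof.
congr col_mx; apply/colP => i; rewrite !mxE.
exact: (derive_cst (Phi z.1)).
Qed.

(** Where h > 0 its multiplier vanishes, and the multiplier of the equality
    constraint must be grad Phi; what remains is the KKT condition of u |->
    Phi (w u) on the set b >= 0. *)
Lemma P_criticalP (z : Z) : 0 < h z.1 ->
  P_critical Phi h b w z <->
  [/\ z.1 = w z.2, 0 <= b z.2 & exists mu, [/\ 0 <= mu, mu * b z.2 = 0 &
    (jac w z.2)^T *m grad Phi z.1 = mu *: grad b z.2]].
Proof.
move=> hpos; rewrite /P_critical; split.
  move=> [[/eqP zeq zin] [l [mu [mu0 mucompl]]]].
  rewrite grad2_fst P_eq_jacT P_ineq_jacT add_col_mx => /eq_col_mx[e1 e2].
  move: zeq; rewrite subr_eq0 => /eqP zeq.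
  have b0 : 0 <= b z.2 by have := zin 1; rewrite mxE.
  have mu00 : mu 0 0 = 0.
    have := mucompl 0; rewrite mxE eqxx => /eqP.
    by rewrite mulf_eq0 (gt_eqF hpos) orbF => /eqP.
  split => //; exists (mu 1 0); split => //.
    by have := mucompl 1; rewrite mxE.
  move: e1; rewrite mu00 scale0r addr0 => ->.
  by apply/esym/eqP; rewrite -subr_eq0 addrC; apply/eqP.
move=> [zeq b0 [mu [mu0 mub muE]]]; split.
  split; first by rewrite /P_eq zeq subrr.
  by move=> i; rewrite mxE; case: ifP => // _; exact: ltW.
exists (grad Phi z.1), (\col_(i < 2) (if i == 0 then 0 else mu)); split.
- by move=> i; rewrite mxE; case: ifP.
- by move=> i; rewrite !mxE; case: ifP => // _; rewrite mul0r.
rewrite grad2_fst P_eq_jacT P_ineq_jacT add_col_mx !mxE /= scale0r addr0.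
by rewrite muE addrC subrr.
Qed.

(** A nearby feasible u at which Phi o w is not larger than at us would itself
    be a local minimizer, hence a second critical point. *)
Lemma strict_local_min (xs : 'cV[R]_n) (us : 'cV[R]_m) (N : set Z) :
  (forall u, b u = 0 -> grad b u <> 0) ->
  P_local_minimizer Phi h b w (xs, us) -> 0 < h xs -> nbhs (xs, us) N ->
  (forall z, N z -> P_critical Phi h b w z -> z = (xs, us)) ->
  \forall u \near us, 0 <= b u -> u != us -> Phi (w us) < Phi (w u).
Proof.
move=> gb [[/eqP]]; rewrite subr_eq0 /= => /eqP xsE _ locmin hxs nN crit.
pose mz u : Z := (w u, u).
have wc : continuous w by move=> u; exact: differentiable_continuous.
have mzc : {for us, continuous mz}.
  have idc : (id : 'cV[R]_m -> 'cV[R]_m) u @[u --> us] --> us by exact: cvg_id.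
  exact: (cvg_pair (wc us) idc).
have mzs : mz us = (xs, us) by rewrite /mz -xsE.
have nearN : \forall u \near us, N (mz u).
  by apply: (mzc N); rewrite mzs.
have nearh : \forall u \near us, 0 < h (w u).
  have hwc : {for us, continuous (h \o w)}.
    by apply: continuous_comp => //; exact: differentiable_continuous.
  by apply: (cvgr_gt _ hwc); rewrite /= -xsE.
have nearmin : \forall u \near us, 0 <= b u -> Phi (w us) <= Phi (w u).
  have : \forall u \near us, P_feasible h b w (mz u) -> Phi xs <= Phi (mz u).1.
    apply: (mzc [set z | P_feasible h b w z -> Phi xs <= Phi z.1]).
    by rewrite mzs.
  move=> H; near=> u => b0.
  rewrite -xsE; have : P_feasible h b w (mz u) -> Phi xs <= Phi (mz u).1.
    by near: u.
  apply; split; first by rewrite /P_eq subrr.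
  move=> i; rewrite mxE; case: ifP => // _.
  have : 0 < h (w u) by near: u.
  exact: ltW.
have nearnear : \forall u \near us, \forall u' \near u,
    0 <= b u' -> Phi (w us) <= Phi (w u').
  exact: nbhs_interior nearmin.
near=> u => b0; apply: contraNlt => uus.
have hu : 0 < h (w u) by near: u.
have Nu : N (mz u) by near: u.
have minu : \forall u' \near u, 0 <= b u' -> Phi (w u) <= Phi (w u').
  have : \forall u' \near u, 0 <= b u' -> Phi (w us) <= Phi (w u').
    by near: u.
  by apply: filterS => u' H /H; exact: le_trans.
have dphi : differentiable (fun u => Phi (w u)) u.
  exact: (differentiable_comp (dw u) (dPhi (w u))).
have [mu muP] := local_min_KKT dphi (db u) minu b0 (gb u).
have : P_critical Phi h b w (mz u).
  by apply/P_criticalP => //; split => //; exists mu; rewrite -grad_comp.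
by move/(crit _ Nu) => [_ ->].
Unshelve. all: by end_near. Qed.

End ProblemP.

(** * Interaction of the plant with the input dynamics *)

Section Coupling.
Context {R : realType} {n m : nat}.
Notation Z := ('cV[R]_n * 'cV[R]_m)%type.

Lemma quadratic_form_le d k (G : 'M[R]_(k, d)) : exists2 B : R, 0 <= B &
  forall e v : 'cV[R]_d, `|dot (G *m e) (G *m v)| <= B * (`|e| * `|v|).
Proof.
exists (k%:R * ((d%:R * `|G|) * (d%:R * `|G|))).
  by rewrite !mulr_ge0.
move=> e v; apply: le_trans (dot_le_norm _ _) _.
rewrite -[leRHS]mulrA ler_wpM2l //.
rewrite (_ : _ * (`|e| * _) = (d%:R * (`|G| * `|e|)) * (d%:R * (`|G| * `|v|))).
  by rewrite ler_pM // norm_mulmx_le.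
by ring.
Qed.

Let coupling_arith (c B eta Bw k d1 d2 d3 d4 E P : R) :
  d1 <= - c * E -> d2 <= B * eta * E -> - d3 <= B * Bw * P -> d4 <= k * P ->
  2 * (B * eta * E) <= c * E ->
  2 * (d1 + d2 - d3) + d4 <= - c * E + (2 * (B * Bw) + k) * P.
Proof. lra. Qed.

(** The derivative of |G e|^2 for e = x - w(u), plus the error made in the
    descent of Phi (w u) by evaluating grad Phi at x instead of w u. The first
    is at most -2c|e|^2 for the linearization at us; strict differentiability
    makes the remainder of f cost at most c|e|^2, and the two cross terms with
    the input velocity q are bounded by |e||q|. *)
Lemma coupling_bound (f : 'cV[R]_n -> 'cV[R]_m -> 'cV[R]_n)
    (Phi : 'cV[R]_n -> R) (w : 'cV[R]_m -> 'cV[R]_n) (us : 'cV[R]_m) :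
  Ck 1 (fun z : Z => f z.1 z.2) -> Ck 2 Phi -> Ck 2 w ->
  (forall u, f (w u) u = 0) -> globally_exp_stable f us (w us) ->
  exists (G : 'M[R]_(n + n, n)) (c C : R), [/\ 0 < c, 0 <= C,
    forall e : 'cV[R]_n, c * `|e| ^+ 2 <= dot (G *m e) (G *m e) &
    \forall z \near (w us, us), forall q : 'cV[R]_m,
      let e := z.1 - w z.2 in
      2 * dot (G *m e) (G *m (f z.1 z.2 - jac w z.2 *m q))
      + dot ((jac w z.2)^T *m (grad Phi (w z.2) - grad Phi z.1)) q
      <= - c * `|e| ^+ 2 + C * (`|e| * `|q|)].
Proof.
move=> Cf CPhi Cw fw0 ges.
have hurw := exp_stable_hurwitz Cf (fw0 us) ges.
have [G [c [c0 HG]]] := hurwitz_quadratic_form hurw.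
have [B B0 HB] := quadratic_form_le G.
(* The remainder of the linearization then costs at most half of the decay. *)
pose eta : R := c / (2 * (B + 1)).
have eta0 : 0 < eta by rewrite divr_gt0 // mulr_gt0 // ltr_wpDl.
have Beta : 2 * (B * eta) <= c.
  rewrite (_ : 2 * _ = c * (B / (B + 1))); last first.
    by rewrite /eta; field; rewrite gt_eqF // ltr_wpDl.
  by rewrite ger_pMr // ler_pdivrMr ?ltr_wpDl // mul1r lerDl.
have CgradPhi : Ck 1 (fun z : Z => grad Phi z.1).
  by apply: Ck_fst; exact: Ck_grad.
have near1 := strict_jac_fst (w us, us) Cf eta0.
have near2 := strict_jac_fst (w us, us) CgradPhi (ltr01 : (0 : R) < 1).
set A := jac (fun y => f (y, us).1 (y, us).2) (w us) in near1.
set J := jac (fun y => grad Phi (y, us).1) (w us) in near2.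
have [rho rho0 [H1 H2]] := near_right_witness (filterI near1 near2).
have wc : continuous w by exact: Ck_continuous Cw.
have jwc : continuous (jac w) by apply: (@Ck_continuous _ _ _ 1); exact: Ck_jac.
pose L : R := n%:R * `|J| + 1.
have L0 : 0 <= L by rewrite addr_ge0 // mulr_ge0.
pose Bw : R := m%:R * (`|jac w us| + 1).
have Bw0 : 0 <= Bw by rewrite mulr_ge0 // addr_ge0.
pose C : R := 2 * (B * Bw) + n%:R * (L * Bw).
have C0 : 0 <= C by rewrite /C addr_ge0 // !mulr_ge0.
exists G, c, C; split => // [e|]; first by case: (HG e).
have nu : \forall z \near (w us, us),
    [/\ `|z.1 - w us| < rho, `|z.2 - us| < rho,
        `|w z.2 - w us| < rho & `|jac w z.2 - jac w us| <= 1].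
  have c1 : {for (w us, us), continuous (fst : Z -> 'cV[R]_n)} by exact: cvg_fst.
  have c2 : {for (w us, us), continuous (snd : Z -> 'cV[R]_m)} by exact: cvg_snd.
  have c3 : {for (w us, us), continuous (fun z : Z => w z.2)}.
    exact: (continuous_comp c2 (wc _)).
  have c4 : {for (w us, us), continuous (fun z : Z => jac w z.2)}.
    exact: (continuous_comp c2 (jwc _)).
  near=> z; split; rewrite distrC; near: z.
  - by move/cvgrPdist_lt : c1; apply.
  - by move/cvgrPdist_lt : c2; apply.
  - by move/cvgrPdist_lt : c3; apply.
  - by move/cvgrPdist_le : c4; apply.
apply: filterS nu => -[x u] /= [xr ur wr jr] q; set e := x - w u.
have jwb : `|jac w u| <= `|jac w us| + 1.
  rewrite -[jac w u](subrK (jac w us)) addrC.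
  by rewrite (le_trans (ler_normD _ _)) // lerD2l.
set y := jac w u *m q.
have yb : `|y| <= Bw * `|q|.
  apply: le_trans (norm_mulmx_le _ _) _.
  by rewrite /Bw -mulrA ler_wpM2l // ler_wpM2r.
have fE : `|f x u - A *m e| <= eta * `|e|.
  by have := H1 x (w u) u xr wr ur; rewrite /= fw0 subr0.
have gE : `|grad Phi (w u) - grad Phi x| <= L * `|e|.
  have := H2 x (w u) u xr wr ur; rewrite /= mul1r -/e => He.
  rewrite distrC -[grad Phi x - _](subrK (J *m e)).
  rewrite (le_trans (ler_normD _ _)) // /L mulrDl mul1r addrC lerD //.
  by rewrite -mulrA norm_mulmx_le.
clearbody e.
have t1 : dot (G *m e) (G *m (f x u - y)) =
    dot (G *m e) (G *m (A *m e)) + dot (G *m e) (G *m (f x u - A *m e))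
    - dot (G *m e) (G *m y).
  by rewrite !mulmxBr !dotDr !dotNr; ring.
have [t2 _] := HG e.
have t3 : dot (G *m e) (G *m (f x u - A *m e)) <= B * eta * `|e| ^+ 2.
  apply: le_trans (ler_norm _) _; apply: le_trans (HB _ _) _.
  rewrite -mulrA ler_wpM2l // expr2 mulrCA ler_wpM2l //.
have t4 : - dot (G *m e) (G *m y) <= B * Bw * (`|e| * `|q|).
  rewrite -dotNr -mulmxN.
  apply: le_trans (ler_norm _) _; apply: le_trans (HB _ _) _.
  by rewrite normrN -mulrA ler_wpM2l // mulrCA ler_wpM2l.
have t5 : dot ((jac w u)^T *m (grad Phi (w u) - grad Phi x)) q <=
    n%:R * (L * Bw) * (`|e| * `|q|).
  rewrite -dot_mulmx -/y.
  apply: le_trans (ler_norm _) _; apply: le_trans (dot_le_norm _ _) _.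
  rewrite -mulrA ler_wpM2l //.
  rewrite (_ : L * Bw * _ = (L * `|e|) * (Bw * `|q|)); last by ring.
  by rewrite ler_pM.
have Be : 2 * (B * eta * `|e| ^+ 2) <= c * `|e| ^+ 2.
  by rewrite mulrA ler_wpM2r ?sqr_ge0.
by rewrite /C t1; exact: coupling_arith t2 t3 t4 t5 Be.
Unshelve. all: by end_near. Qed.

End Coupling.

(** * The controller near the optimum *)

Section Controller.
Context {R : realType} {n m : nat}.
Notation Z := ('cV[R]_n * 'cV[R]_m)%type.
Variables (f : 'cV[R]_n -> 'cV[R]_m -> 'cV[R]_n) (Phi h : 'cV[R]_n -> R).
Variables (b : 'cV[R]_m -> R) (w : 'cV[R]_m -> 'cV[R]_n).
Variables (beta : R) (r : nat) (eps alpha gamma : R).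

Definition reduced_gradient (z : Z) : 'cV[R]_m :=
  (jac w z.2)^T *m grad Phi z.1.

(** The minimizer of the quadratic program when only the input constraint can
    be active, lam being its multiplier. *)
Definition control (lam : R) (z : Z) : 'cV[R]_m :=
  lam *: grad b z.2 - eps *: reduced_gradient z.

(** If the projection on the half-space of the input constraint also satisfies
    the state constraint, it is the minimizer over the smaller feasible
    set. *)
Lemma QP_minimizerE lam (z : Z) q : 0 <= lam ->
  lam * (dot (grad b z.2) (control lam z) + alpha * b z.2) = 0 ->
  0 <= dot (grad b z.2) (control lam z) + alpha * b z.2 ->
  0 <= QP_ineq f h b beta r alpha gamma (control lam z) z 1 0 ->
  QP_minimizer f Phi h b w beta r eps alpha gamma z q -> q = control lam z.
Proof.
move=> lam0 compl feas0 feas1 [feasq minq].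
have feasc : QP_feasible f h b beta r alpha gamma z (control lam z).
  move=> i; have [->|i0] := eqVneq i 0; first by rewrite mxE eqxx.
  have -> : i = 1 by case: i i0 => -[|[|]] // ? _; exact: val_inj.
  exact: feas1.
have := minq _ feasc.
have fq : 0 <= dot (grad b z.2) q + alpha * b z.2.
  by have := feasq 0; rewrite mxE eqxx.
have := halfspace_projection lam0 (erefl _) compl fq.
rewrite /QP_cost -/(reduced_gradient z) ler_pM2l ?invr_gt0 //.
move=> h1 /(le_trans h1); rewrite gerDl => h2.
apply/eqP; rewrite -subr_eq0; apply: contraTT h2 => ne.
by rewrite -ltNge dotxx_gt0.
Qed.

Lemma QP_ineq1_continuous (z0 : Z) (q : Z -> 'cV[R]_m) : (1 <= r)%N ->
  Ck r.+1 (fun z : Z => f z.1 z.2) -> Ck r.+2 h -> {for z0, continuous q} ->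
  {for z0, continuous (fun z => QP_ineq f h b beta r alpha gamma (q z) z 1 0)}.
Proof.
move=> r1 Cf Ch qc.
have Ch1 : Ck 1 (fun z : Z => hseq f h beta r z.1 z.2).
  have Cf' : Ck (r + 1) (fun z : Z => f z.1 z.2) by rewrite addn1.
  have Ch' : Ck (r + 2) h by rewrite addn2.
  have := Ck_hseq beta Cf' Ch' (leqnn r).
  by rewrite subnn; exact: CkW.
have fc : {for z0, continuous (fun z : Z => f z.1 z.2)}.
  exact: (Ck_continuous Cf).
have gx : {for z0, continuous
    (fun z : Z => grad (fun x => hseq f h beta r x z.2) z.1)}.
  apply: (@Ck_continuous _ _ _ 0); apply: Ck_mx => i j.
  rewrite ord1; under eq_fun do rewrite (grad_fstE (fun z => hseq f h beta r z.1 z.2)).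
  by case: Ch1 => _ D; exact: D.
have gu : {for z0, continuous
    (fun z : Z => grad (fun u => hseq f h beta r z.1 u) z.2)}.
  apply: (@Ck_continuous _ _ _ 0); apply: Ck_mx => i j.
  rewrite ord1; under eq_fun do rewrite (grad_sndE (fun z => hseq f h beta r z.1 z.2)).
  by case: Ch1 => _ D; exact: D.
have -> : (fun z => QP_ineq f h b beta r alpha gamma (q z) z 1 0) = fun z : Z =>
    dot (grad (fun x => hseq f h beta r x z.2) z.1) (f z.1 z.2)
    + dot (grad (fun u => hseq f h beta r z.1 u) z.2) (q z)
    + gamma * hseq f h beta r z.1 z.2.
  by apply/funext => z; rewrite mxE.
apply: cvgD; first apply: cvgD.
- exact: (dot_continuous gx fc).
- exact: (dot_continuous gu qc).
by apply: cvgM; [exact: cvg_cst|exact: (Ck_continuous Ch1)].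
Qed.

(** The input constraint of the quadratic program says b' >= - alpha b, so
    exp(alpha t) b is nondecreasing. *)
Lemma barrier_invariant (T : \bar R) (z : R -> Z) : 
  (forall u, differentiable b u) ->
  CL_solution f Phi h b w beta r eps alpha gamma T z ->
  forall a t : R, 0 <= a -> a <= t -> (t%:E < T)%E ->
    0 <= b (z a).2 -> 0 <= b (z t).2.
Proof.
move=> db sol a t a0 at_ tT ba.
have /choice[q Hq] : forall s, exists q, a <= s <= t ->
    QP_minimizer f Phi h b w beta r eps alpha gamma (z s) q /\
    is_derive s (1 : R) (fun s => (z s).2) q.
  move=> s; have [/andP[as_ st]|no] := boolP (a <= s <= t); last by exists 0.
  have sT : (s%:E < T)%E by apply: le_lt_trans tT; rewrite lee_fin.
  by have [_ [q minq dq]] := sol s (le_trans a0 as_) sT; exists q.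
pose g s := expR (alpha * s) * b (z s).2.
pose g' s := expR (alpha * s) *
  (dot (grad b (z s).2) (q s) + alpha * b (z s).2).
have dg s : a <= s <= t -> is_derive s (1 : R) g (g' s).
  move=> /Hq[_ dq].
  have db' := is_derive_grad (db (z s).2) dq.
  have dl : is_derive s (1 : R) (fun s : R => alpha * s) alpha.
    have := @is_deriveZ _ _ _ id alpha s 1 1 (is_derive_id s 1).
    by rewrite /GRing.scale /= mulr1.
  have de : is_derive s (1 : R) (fun s => expR (alpha * s))
      (alpha * expR (alpha * s)).
    by have := is_derive1_comp (is_derive_expR (alpha * s)) dl; rewrite mulrC.
  have := @is_deriveM _ _ _ _ s 1 _ _ de db'.
  move=> H; apply: is_derive_eq H _.
  by rewrite /g' /GRing.scale /=; ring.
have g'0 s : a <= s <= t -> 0 <= g' s.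
  move=> /Hq[[feas _] _]; rewrite mulr_ge0 ?expR_ge0 //.
  by have := feas 0; rewrite mxE eqxx.
have := @derive_ge_increment R g g' a t 0 at_ dg g'0.
rewrite mul0r subr_ge0 => ga.
have : 0 <= g t by apply: le_trans ga; rewrite mulr_ge0 ?expR_ge0.
by rewrite /g pmulr_rge0 ?expR_gt0.
Qed.

End Controller.

(** * Stability of the closed loop *)

Section ClosedLoop.
Context {R : realType} {n m : nat}.
Notation Z := ('cV[R]_n * 'cV[R]_m)%type.

(** Complementarity gives eps p.q = - lam s - |q|^2, in which lam s is
    nonnegative on the feasible set. *)
Lemma slow_decrease d (p a q : 'cV[R]_d) (s lam eps : R) : 0 < eps ->
  0 <= lam -> 0 <= s -> q = lam *: a - eps *: p ->
  lam * (dot a q + s) = 0 -> dot p q <= - (eps^-1 * `|q| ^+ 2).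
Proof.
move=> eps0 lam0 s0 qE compl.
have epq : eps * dot p q = - (lam * s) - dot q q.
  have -> : eps * dot p q = dot (eps *: p) q by rewrite dotZl.
  have -> : eps *: p = lam *: a - q by rewrite qE opprB addrCA subrr addr0.
  rewrite dotDl dotNl dotZl; congr (_ - _); apply/eqP.
  by rewrite -subr_eq0 opprK -mulrDr compl.
have : eps * dot p q <= - `|q| ^+ 2.
  have := sqr_norm_le_dot q; have : 0 <= lam * s by rewrite mulr_ge0.
  by rewrite epq; lra.
by rewrite -ler_pdivlMl // mulrN.
Qed.

(** The discriminant condition C^2 <= c / eps lets the two squares absorb the
    cross term, half of each being left over. *)
Lemma rate_arith (c C eps E Q : R) : 0 < c -> 0 < eps -> eps * C ^+ 2 <= c ->
  - c * E ^+ 2 + C * (E * Q) - eps^-1 * Q ^+ 2 <=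
  - (eps^-1 / 2 * Q ^+ 2 + c / 2 * E ^+ 2).
Proof.
move=> c0 eps0 epsC; set y := eps^-1.
have y0 : 0 < y by rewrite invr_gt0.
have Cy : C ^+ 2 <= c * y by rewrite /y ler_pdivlMr // mulrC.
have : 0 <= c * (c * E ^+ 2 + y * Q ^+ 2 - 2 * (C * (E * Q))).
  have -> : c * (c * E ^+ 2 + y * Q ^+ 2 - 2 * (C * (E * Q))) =
      (c * E - C * Q) ^+ 2 + (c * y - C ^+ 2) * Q ^+ 2 by ring.
  by rewrite addr_ge0 ?sqr_ge0 // mulr_ge0 ?sqr_ge0 // subr_ge0.
rewrite pmulr_rge0 //; lra.
Qed.

Lemma near_cball (V : normedModType R) (z0 : V) (P : V -> Prop) :
  (\forall z \near z0, P z) ->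
  exists2 rho : R, 0 < rho & forall z, `|z - z0| <= rho -> P z.
Proof.
case/nbhs_ballP => rho /= rho0 HP; exists (rho / 2); first by rewrite divr_gt0.
move=> z zr; apply: HP; rewrite -ball_normE /= distrC.
by apply: le_lt_trans zr _; rewrite ltr_pdivrMr // ltr_pMr // ltr1n.
Qed.

Variables (f : 'cV[R]_n -> 'cV[R]_m -> 'cV[R]_n) (Phi h : 'cV[R]_n -> R).
Variables (b : 'cV[R]_m -> R) (w : 'cV[R]_m -> 'cV[R]_n).
Variables (beta : R) (r : nat) (eps alpha gamma : R).

(** The closed loop as a differential inclusion: the controller is only given
    through its graph. *)
Definition closed_loop_rhs (z v : Z) : Prop :=
  v.1 = f z.1 z.2 /\ QP_minimizer f Phi h b w beta r eps alpha gamma z v.2.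

Lemma CL_solutionP (T : \bar R) (z : R -> Z) :
  CL_solution f Phi h b w beta r eps alpha gamma T z <->
  ode_solution closed_loop_rhs T z.
Proof.
split=> sol t t0 tT.
  have [d1 [q minq d2]] := sol t t0 tT.
  by exists (f (z t).1 (z t).2, q); [|apply/is_derive_pairP].
have [v [v1 minv] /is_derive_pairP[d1 d2]] := sol t t0 tT.
by rewrite -v1; split => //; exists v.2.
Qed.

Lemma scaled_gradient_continuous : Ck 2 Phi -> Ck 2 w ->
  continuous (fun z : Z => eps *: reduced_gradient Phi w z).
Proof.
move=> CPhi Cw z.
have rgc : continuous (reduced_gradient Phi w).
  apply: (@Ck_continuous _ _ _ 1); apply: Ck_mulmx.
    by apply: Ck_trmx; apply: Ck_snd; exact: Ck_jac.
  by apply: Ck_fst; exact: Ck_grad.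
by apply: cvgZ; [exact: cvg_cst|exact: rgc].
Qed.

Lemma control_continuous (lam : Z -> R) z :
  Ck 2 b -> Ck 2 Phi -> Ck 2 w -> {for z, continuous lam} ->
  {for z, continuous (fun z => control Phi b w eps (lam z) z)}.
Proof.
move=> Cb CPhi Cw lamc.
have gbc : continuous (fun z : Z => grad b z.2).
  by apply: (@Ck_continuous _ _ _ 1); apply: Ck_snd; exact: Ck_grad.
apply: cvgB; first by apply: cvgZ; [exact: lamc|exact: gbc].
exact: scaled_gradient_continuous.
Qed.

End ClosedLoop.

Unset Implicit Arguments.

Theorem mainTheorem6 (R : realType) (n m : nat)
  (f : 'cV[R]_n -> 'cV[R]_m -> 'cV[R]_n) (Phi h : 'cV[R]_n -> R)
  (b : 'cV[R]_m -> R) (w : 'cV[R]_m -> 'cV[R]_n)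
  (beta : R) (r : nat) (alpha : R)
  (xs : 'cV[R]_n) (us : 'cV[R]_m) (N : set ('cV[R]_n * 'cV[R]_m))
  (beta_gt0 : 0 < beta) (alpha_gt0 : 0 < alpha)
  (A1 : assumptionA1 f w)
  (A2 : assumptionA2 f Phi h b w beta r)
  (loc_min : P_local_minimizer Phi h b w (xs, us))
  (hxs_gt0 : 0 < h xs)
  (N_nbhs : nbhs (xs, us) N)
  (only_critical : forall z, N z -> (P_critical Phi h b w z <-> z = (xs, us)))
  (level_sets : forall c : R, compact [set u | Phi (w u) = c])
  (P_CQ : P_MFCQ_in h b w N \/ P_CRCQ_in h b w N) :
  exists eps_s gamma_s : R, [/\ 0 < eps_s, 0 < gamma_s &
    forall eps gamma : R, 0 < eps -> eps < eps_s -> gamma_s <= gamma ->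
      (forall z, N z -> exists q, QP_feasible f h b beta r alpha gamma z q) ->
      (QP_MFCQ_in f Phi h b w beta r eps alpha gamma N \/
       QP_CRCQ_in f Phi h b w beta r eps alpha gamma N) ->
      unique_solutions_from (CL_solution f Phi h b w beta r eps alpha gamma) N ->
      asymptotically_stable_rel
        (CL_solution f Phi h b w beta r eps alpha gamma)
        (Xset f h b beta r) (xs, us)].
Proof.
move: A2 => [[r1 [Cf Ch] _ _ _] [Cb gradb_neq0] [CPhi Cw]].
pose Z := ('cV[R]_n * 'cV[R]_m)%type.
have Cf1 : Ck 1 (fun z : Z => f z.1 z.2).
  exact: (Ck_le (isT : (1 <= r.+1)%N) Cf).
have dPhi x : differentiable Phi x by case: CPhi.
have dh x : differentiable h x by case: Ch.
have db u : differentiable b u by case: Cb.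
have dw u : differentiable w u by case: Cw.
have fw0 u : f (w u) u = 0 by apply/(A1 u).1.
have xsE : xs = w us.
  by have [[/eqP]] := loc_min; rewrite subr_eq0 => /eqP.
have gb u : b u = 0 -> grad b u <> 0.
  by move=> bu0; apply: (gradb_neq0 xs) => //; [exact: ltW|rewrite bu0].
have [G [c [C [c0 C0 HG coupling]]]] :=
  coupling_bound Cf1 CPhi Cw fw0 (A1 us).2.
have zs_crit : P_critical Phi h b w (xs, us).
  by apply/only_critical => //; exact: nbhs_singleton N_nbhs.
have [_ /= bus [mu [mu0 mub muE]]] :=
  (P_criticalP Phi dh db dw (z := (xs, us)) hxs_gt0).1 zs_crit.
have strict := strict_local_min dPhi dh db dw gb loc_min hxs_gt0 N_nbhs
  (fun z Nz => (only_critical z Nz).1).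
have C21 : 0 < C ^+ 2 + 1 by rewrite ltr_wpDl // sqr_ge0.
(* The bound on eps is the discriminant condition eps C^2 <= c. At (xs, us)
   the state constraint reads gamma h_r >= 0 with h_r > 0, so it is slack
   nearby for every gamma > 0. *)
exists (c / (C ^+ 2 + 1)), 1; split => [||eps gamma eps0 eps_lt gamma1 _ _ uniq].
- by rewrite divr_gt0.
- exact: ltr01.
have epsC : eps * C ^+ 2 <= c.
  move: eps_lt; rewrite ltr_pdivlMr // mulrDr mulr1; lra.
have gamma0 : 0 < gamma by exact: lt_le_trans gamma1.
pose zs : Z := (xs, us).
have pc : continuous (fun z : Z => eps *: reduced_gradient Phi w z).
  exact: scaled_gradient_continuous.
have ac : continuous (fun z : Z => grad b z.2).
  by apply: (@Ck_continuous _ _ _ 1); apply: Ck_snd; exact: Ck_grad.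
have bc : continuous (fun z : Z => alpha * b z.2).
  move=> z; apply: cvgM; first exact: cvg_cst.
  by move: z; apply: (@Ck_continuous _ _ _ 2); exact: Ck_snd.
have [lam [lam_zs lamP]] : exists lam : Z -> R,
    lam zs *: grad b us - eps *: reduced_gradient Phi w zs = 0 /\
    \forall z \near zs, [/\ 0 <= lam z,
      lam z * (dot (grad b z.2) (control Phi b w eps (lam z) z)
               + alpha * b z.2) = 0,
      0 <= dot (grad b z.2) (control Phi b w eps (lam z) z) + alpha * b z.2 &
      {for z, continuous lam}].
  apply: (halfspace_multiplier pc ac bc (z0 := zs)) => /=.
  - by rewrite mulr_ge0 // ltW.
  - by move=> /eqP; rewrite mulf_eq0 gt_eqF //= => /eqP; exact: gb.
  - exists (eps * mu); split; first by rewrite mulr_ge0 // ltW.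
      by rewrite mulrCA -!mulrA mub !mulr0.
    by rewrite /reduced_gradient /= muE scalerA.
pose kappa z := control Phi b w eps (lam z) z.
have kappa_zs : kappa zs = 0 by exact: lam_zs.
pose F (z : Z) : Z := (f z.1 z.2, kappa z).
have fc : continuous (fun z : Z => f z.1 z.2) by exact: Ck_continuous Cf.
have kappac z : {for z, continuous lam} -> {for z, continuous kappa}.
  exact: control_continuous.
have Fc z : {for z, continuous lam} -> {for z, continuous F}.
  by move=> /kappac kc; exact: (cvg_pair (fc z) kc).
have lamc_zs : {for zs, continuous lam} by case: (nbhs_singleton lamP).
have ineq1_near : \forall z \near zs,
    0 < QP_ineq f h b beta r alpha gamma (kappa z) z 1 0.
  apply: (cvgr_gt _ (QP_ineq1_continuous (b := b) (beta := beta) (alpha := alpha)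
    (gamma := gamma) r1 Cf Ch (kappac zs lamc_zs))).
  rewrite mxE /= kappa_zs dot0r addr0 xsE fw0 dot0r add0r.
  by rewrite hseq_equilibrium // -xsE !mulr_gt0 // exprn_gt0.
have F_near : \forall z \near zs, `|F z| < 1.
  have nFc : {for zs, continuous (fun z => `|F z|)}.
    by apply: cvg_norm; exact: Fc.
  apply: (cvgr_lt _ nFc); rewrite /F kappa_zs /= xsE fw0.
  by rewrite (_ : (0, 0) = 0 :> Z) // normr0.
have strict_near : \forall z \near zs,
    0 <= b z.2 -> z.2 != us -> Phi (w us) < Phi (w z.2).
  have sc : {for zs, continuous (snd : Z -> 'cV[R]_m)} by exact: cvg_snd.
  exact: (sc _ strict).
have h_near : \forall z \near zs, 0 < h z.1.
  have hc : {for zs, continuous (fun z : Z => h z.1)}.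
    by apply: (@Ck_continuous _ _ _ r.+2); exact: Ck_fst.
  exact: (cvgr_gt _ hc).
rewrite -xsE in coupling.
(* A ball on which all local facts hold at once. *)
have [rho rho0 good] := near_cball (filterI lamP (filterI ineq1_near
  (filterI F_near (filterI strict_near (filterI h_near
  (filterI coupling N_nbhs)))))).
pose K := [set z : Z | `|z - zs| <= rho].
pose S := [set z : Z | 0 <= b z.2].
pose e (z : Z) := z.1 - w z.2.
(* V is the reduced cost plus the quadratic form of the distance to steady
   state; D bounds its decay. *)
pose V (z : Z) := Phi (w z.2) - Phi (w us) + dot (G *m e z) (G *m e z).
pose D (z : Z) := eps^-1 / 2 * `|kappa z| ^+ 2 + c / 2 * `|e z| ^+ 2.
have eps_inv2 : 0 < eps^-1 / 2 by rewrite divr_gt0 // invr_gt0.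
have minE z q : K z ->
    QP_minimizer f Phi h b w beta r eps alpha gamma z q -> q = kappa z.
  move=> /good[[l0 l1 l2 _] [i1 _]]; apply: QP_minimizerE => //; exact: ltW.
have sol_der T z : CL_solution f Phi h b w beta r eps alpha gamma T z ->
    forall t : R, 0 <= t -> (t%:E < T)%E -> K (z t) ->
    is_derive t (1 : R) (fun s => (z s).1) (f (z t).1 (z t).2) /\
    is_derive t (1 : R) (fun s => (z s).2) (kappa (z t)).
  move=> sol t t0 tT Kz; have [d1 [q minq d2]] := sol t t0 tT.
  by rewrite -(minE _ _ Kz minq).
have diss T z : CL_solution f Phi h b w beta r eps alpha gamma T z ->
    dissipative V D S zs rho T z.
  move=> sol; split.
  - move=> t t0 tT; have /CL_solutionP/(_ t t0 tT)[v _ dv] := sol.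
    exact: is_derive_continuous dv.
  - move=> t t0 tT Kz Sz.
    have [d1 d2] := sol_der T z sol t t0 tT Kz.
    have [[l0 l1 l2 _] [_ [_ [_ [_ [coup _]]]]]] := good _ Kz.
    set q := kappa (z t) in d2 l1 l2.
    pose y := jac w (z t).2 *m q.
    have dw' : is_derive t (1 : R) (fun s => w (z s).2) y.
      exact: is_derive_jac.
    have dPhi' := is_derive_grad (dPhi (w (z t).2)) dw'.
    have de : is_derive t (1 : R) (fun s => e (z s)) (f (z t).1 (z t).2 - y).
      exact: is_deriveB.
    have dE := is_derive_dotxx (is_derive_mulmx G de).
    have dV := @is_deriveD _ _ _ _ _ t 1 _ _
      (@is_deriveB _ _ _ _ (cst (Phi (w us))) t 1 _ _ dPhi'
        (is_derive_cst (Phi (w us)) t 1)) dE.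
    exists (dot (grad Phi (w (z t).2)) y - 0
        + 2 * dot (G *m e (z t)) (G *m (f (z t).1 (z t).2 - y))).
      exact: dV.
    have slow : dot (reduced_gradient Phi w (z t)) q <= - (eps^-1 * `|q| ^+ 2).
      apply: (slow_decrease eps0 l0 _ (erefl q) l1).
      by rewrite mulr_ge0 // ltW.
    have := coup q; rewrite -/(e (z t)) -/y => /= coupq.
    have gsplit : dot (grad Phi (w (z t).2)) y =
        dot ((jac w (z t).2)^T *m (grad Phi (w (z t).2) - grad Phi (z t).1)) q
        + dot (reduced_gradient Phi w (z t)) q.
      by rewrite -dotDl -mulmxDr subrK -dot_mulmx.
    have := rate_arith `|e (z t)| `|q| c0 eps0 epsC.
    rewrite /D -/q subr0 gsplit; lra.
  - by move=> a t a0 at_ tT _ Sa; exact: (barrier_invariant db sol a0 at_ tT Sa).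
have ec z : {for z, continuous e}.
  apply: cvgB; first exact: cvg_fst.
  by move: z; apply: (@Ck_continuous _ _ _ 2); exact: Ck_snd.
have Vc z : `|z - zs| <= rho -> {for z, continuous V}.
  move=> _; apply: cvgD; first apply: cvgB; last 1 first.
  - have Gec : {for z, continuous (fun z => G *m e z)}.
      have Cm : continuous (fun v : 'cV[R]_n => G *m v).
        by apply: (@Ck_continuous _ _ _ 0); apply: Ck_mulmx;
           [exact: Ck_cst|move=> ?; exact: cvg_id].
      exact: (continuous_comp (ec z) (Cm _)).
    exact: (dot_continuous Gec Gec).
  - have wz : {for z, continuous (fun z : Z => w z.2)}.
      by move: z; apply: (@Ck_continuous _ _ _ 2); exact: Ck_snd.
    have Phic : continuous Phi by exact: Ck_continuous CPhi.
    exact: (@continuous_comp _ _ _ (fun z : Z => w z.2) Phi z wz (Phic _)).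
  - exact: cvg_cst.
have sqr_cont (g : Z -> R) z : {for z, continuous g} ->
    {for z, continuous (fun z => g z ^+ 2)}.
  by move=> gc; apply: cvgM.
have Dc z : `|z - zs| <= rho -> {for z, continuous D}.
  move=> /good[[_ _ _ lamc] _]; apply: cvgD; apply: cvgM.
  - exact: cvg_cst.
  - by apply: (sqr_cont (fun z => `|kappa z|)); apply: cvg_norm; exact: kappac.
  - exact: cvg_cst.
  - by apply: (sqr_cont (fun z => `|e z|)); apply: cvg_norm; exact: ec.
have V0 : V zs = 0.
  by rewrite /V /e /= -xsE !subrr mulmx0 dot0r addr0.
have D_ge0 z : 0 <= D z.
  by rewrite addr_ge0 // mulr_ge0 ?sqr_ge0 ?ltW // divr_gt0.
have VD z : `|z - zs| <= rho -> S z -> z != zs -> 0 < V z /\ 0 < D z.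
  move=> Kz Sz zne.
  have [[l0 l1 _ _] [_ [_ [str [hz [_ Nz]]]]]] := good _ Kz.
  have e2 : 0 <= `|e z| ^+ 2 by exact: sqr_ge0.
  have E0 : 0 <= dot (G *m e z) (G *m e z) by exact: dotxx_ge0.
  split.
    have [u_eq|une] := eqVneq z.2 us; last first.
      by rewrite /V ltr_pwDl // subr_gt0; exact: str.
    rewrite /V u_eq subrr add0r; apply: lt_le_trans (HG (e z)).
    rewrite mulr_gt0 // exprn_gt0 // normr_gt0 /e u_eq -xsE subr_eq0.
    apply: contraNneq zne => x_eq.
    by rewrite [z]surjective_pairing x_eq u_eq.
  have c2 : 0 < c / 2 by rewrite divr_gt0.
  have kappa_part : 0 <= eps^-1 / 2 * `|kappa z| ^+ 2.
    by rewrite mulr_ge0 ?sqr_ge0 // ltW.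
  have e_part : 0 <= c / 2 * `|e z| ^+ 2 by rewrite mulr_ge0 // ltW.
  have [ez0|ez] := eqVneq (e z) 0; last first.
    apply: ltr_wpDl => //.
    by rewrite mulr_gt0 // exprn_gt0 // normr_gt0.
  have [kz0|kz] := eqVneq (kappa z) 0; last first.
    apply: ltr_pwDl => //.
    by rewrite mulr_gt0 // exprn_gt0 // normr_gt0.
  (* A zero of the dissipation is an equilibrium of the closed loop, and lam
     / eps is its KKT multiplier. *)
  exfalso; move/eqP: zne; apply; apply/(only_critical z Nz).
  apply/P_criticalP => //; split => //.
    by apply/eqP; rewrite -subr_eq0; apply/eqP.
  have lamE : lam z *: grad b z.2 = eps *: reduced_gradient Phi w z.
    by apply/eqP; rewrite -subr_eq0; apply/eqP.
  exists (lam z / eps); split; first by rewrite divr_ge0 // ltW.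
    move: l1; rewrite -/(kappa z) kz0 dot0r add0r mulrCA => /eqP.
    rewrite mulf_eq0 (gt_eqF alpha_gt0) /= => /eqP lb.
    by rewrite mulrAC lb mul0r.
  rewrite -/(reduced_gradient Phi w z) mulrC -scalerA lamE scalerA.
  by rewrite mulVf ?scale1r // gt_eqF.
have cK := @compact_cball_pair R n m zs rho.
have cS : closed S.
  apply: (@closed_comp _ _ (fun z : Z => b z.2) [set x | 0 <= x]).
    move=> z _; move: z; apply: (@Ck_continuous _ _ _ 2); exact: Ck_snd.
  exact: closed_ge.
have trap := lyapunov_trap rho0 cK cS Vc V0 (D_ge0 zs) VD.
split.
  move=> U /nbhs_ballP[rU /= rU0 HU].
  pose rr := Num.min rho (rU / 2).
  have rr0 : 0 < rr by rewrite lt_min rho0 divr_gt0.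
  have rr_rho : rr <= rho by rewrite ge_min lexx.
  have rr_U z : `|z - zs| < rr -> U z.
    move=> zr; apply: HU; rewrite -ball_normE /= distrC.
    apply: lt_trans zr _; rewrite gt_min; apply/orP; right.
    by rewrite ltr_pdivrMr // ltr_pMr // ltr1n.
  have [d d0 Hd] := trap rr rr0 rr_rho.
  exists (ball zs (Num.min d rho)).
    by apply: nbhsx_ballx; rewrite lt_min d0.
  move=> z0; rewrite -ball_normE /= distrC lt_min => /andP[z0d z0rho] [_ Sz0 _].
  have Kz0 : K z0 by exact: ltW.
  have stay T z : CL_solution f Phi h b w beta r eps alpha gamma T z ->
      z 0 = z0 -> forall t : R, 0 <= t -> (t%:E < T)%E -> `|z t - zs| < rr.
    move=> sol zz0 t t0 tT.
    by have [] := Hd T z 0 (diss T z sol) (lexx _) _ _ t t0 tT; rewrite ?zz0.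
  split; last by move=> T z sol zz0 t t0 tT; apply: rr_U; exact: (stay T z).
  have Nz0 : N z0 by have [_ [_ [_ [_ [_ [_ ?]]]]]] := good _ Kz0.
  have [z [sol zz0]] : exists z, ode_solution
      (closed_loop_rhs f Phi h b w beta r eps alpha gamma) +oo%E z /\ z 0 = z0.
    apply: (@global_solution _ _ _ _ K F 1) => //.
    - exact: closed_cball.
    - move=> z [v1 v2] Kz [/= -> minv]; congr pair; exact: minE.
    - by move=> z /good[[_ _ _ lamc] _]; exact: Fc.
    - by move=> z /good[_ [_ [Fz _]]]; exact: ltW.
    - move=> z1 Kz1; have Nz1 : N z1 by have [_ [_ [_ [_ [_ [_ ?]]]]]] := good _ Kz1.
      have [[T [z [T0 sol zz1]]] _] := uniq z1 Nz1.
      by exists T, z; split => //; apply/CL_solutionP.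
    - move=> T1 T2 z1 z2 /CL_solutionP s1 /CL_solutionP s2.
      by have [_] := uniq z0 Nz0; apply.
    - move=> T z /CL_solutionP sol zz0 t t0 tT.
      by apply: ltW; apply: lt_le_trans rr_rho; exact: (stay T z).
  by exists z; split => //; apply/CL_solutionP.
have [d d0 Hd] := trap rho rho0 (lexx _).
exists (ball zs d); first exact: nbhsx_ballx.
move=> z sol; rewrite -ball_normE /= distrC => z0d [_ Sz0 _].
by apply: (lyapunov_attractive rho0 cK cS Vc Dc V0 (D_ge0 zs) VD Hd (diss _ _ sol)).
Qed.
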